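(* Let $p > 7$ be a prime. Then $|\mathrm{Solv}(\mathrm{PSL}(2, p))|$ equals: (1) $\frac{5}{2}p^2 + \frac{5}{2}p + 2$ if $p \equiv 1 \pmod{24}$; (2) $2p^2 + p + 2$ if $p \equiv 5 \pmod{24}$; (3) $\frac{5}{2}p^2 + \frac{1}{2}p + 2$ if $p \equiv 7 \pmod{24}$; (4) $2p^2 + 2$ if $p \equiv 11 \pmod{24}$; (5) $2p^2 + 2p + 2$ if $p \equiv 13 \pmod{24}$; (6) $\frac{5}{2}p^2 + \frac{3}{2}p + 2$ if $p \equiv 17 \pmod{24}$; (7) $2p^2 + p + 2$ if $p \equiv 19 \pmod{24}$; (8) $\frac{5}{2}p^2 - \frac{1}{2}p + 2$ if $p \equiv 23 \pmod{24}$.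
   Context: For a finite group $G$ and $x \in G$, the solvabilizer of $x$ in $G$ is $\mathrm{Sol}_G(x) = \{y \in G : \langle x, y \rangle \text{ is solvable}\}$. $\mathrm{Solv}(G) = \{\mathrm{Sol}_G(x) : x \in G\}$ is the set of distinct solvabilizers of elements of $G$, and $|\mathrm{Solv}(G)|$ is its cardinality. *)

(* Defs.v *)
From HB Require Import structures.
From mathcomp Require Import all_boot all_order all_algebra all_fingroup all_solvable.
Set Implicit Arguments. Unset Strict Implicit. Unset Printing Implicit Defensive.
Import GRing.Theory.
Local Open Scope group_scope.

Definition SL2_set (p : nat) : {set {'GL_2['F_p]}} :=
  [set g : {'GL_2['F_p]} | (\det (GLval g) == 1)%R].

Lemma SL2_group_set p : group_set (SL2_set p).
Proof.
apply/group_setP; split.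
  by rewrite inE GL_1E det1.
move=> x y; rewrite !inE GL_MxE det_mulmx => /eqP -> /eqP ->.
by rewrite mulr1.
Qed.

Canonical SL2 (p : nat) : {group {'GL_2['F_p]}} := Group (SL2_group_set p).

Definition PSL2 (p : nat) := (SL2 p / 'Z(SL2 p))%G.

Definition solvabilizer (gT : finGroupType) (G : {set gT}) (x : gT) : {set gT} :=
  [set y in G | solvable <<[set x; y]>>].

Definition Solv (gT : finGroupType) (G : {set gT}) : {set {set gT}} :=
  [set solvabilizer G x | x in G].

(* Main.v *)
Require Import Defs.
From mathcomp Require Import all_boot all_order all_algebra all_fingroup all_solvable.
From mathcomp Require Import all_field ring zify.
Set Implicit Arguments. Unset Strict Implicit. Unset Printing Implicit Defensive.
Import GRing.Theory.

(* Dividing by the centre Z = {1, -1} changes neither solvability nor the number of solvabilizers,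
   so everything is done in SL(2, F). There the centralizer C(x) of a noncentral x is {a + b x}, and
   commutation is transitive on noncentral elements. If H is solvable and not central, the last term
   of its derived series not contained in Z is either abelian, and then H normalizes some C(a), or
   the preimage of a Klein four-group, and then every noncentral x in H has x^3 or x^4 in Z. Hence
   for a generic x (neither x^3 nor x^4 in Z) Sol(x) is the union of N(C(x)) and of the stabilizers
   of the lines fixed by x, which only depends on C(x). When x has order 2, 3 or 4 modulo Z, the
   elements of C(x) of the same order modulo Z are x and its inverse up to sign, so they have the
   same solvabilizer as x. Conversely Sol(x) determines C(x) and which of the four types x has; the
   separating elements come from dihedral, tetrahedral and octahedral subgroups. It remains to count
   the centralizers, which have order q - 1, q + 1 (and are then cyclic) or 2 q; elements of order
   2, 3, 4 modulo Z occur in such a centralizer exactly when 4, 3, 8 divides its order. *)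

(** * Two by two matrices *)

(** The derived series replaces Dickson's list of subgroups: a solvable subgroup enters only through
    an abelian group, or a Klein four-group modulo Z, that it normalizes. Types are read off the
    trace t: by Cayley-Hamilton, a noncentral x has x^2, x^3 or x^4 central exactly when t = 0, t^2
    = 1 or t (t^2 - 2) = 0 respectively, and t^2 = 4 means unipotent up to sign. Recovering C(x) is
    easy when x fixes a line: for u unipotent, Sol(u) is exactly the stabilizer of its line, so
    Sol(x) shows which lines x fixes. The obstacle is an x without fixed lines, where only
    normalizers of centralizers are left to work with. The bound p > 7, that is p >= 11, makes q - 1
    exceed 8, so that a generator of any torus is generic. The numbers of centralizers of the three
    kinds are q (q + 1) / 2, q (q - 1) / 2 and q + 1; with the single solvabilizer of the central
    elements they give q^2 + q + 2 in all eight cases, and the rest of each formula comes from the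
    divisibilities. *)

Section Matrices2.
Local Open Scope ring_scope.
Variable F : fieldType.
Implicit Types (A B : 'M[F]_2) (v w : 'rV[F]_2) (a b c d : F).

Lemma mx2P A B : A 0 0 = B 0 0 -> A 0 1 = B 0 1 -> A 1 0 = B 1 0 ->
  A 1 1 = B 1 1 -> A = B.
Proof.
move=> h00 h01 h10 h11; apply/matrixP => i j.
have ord2 (k : 'I_2) : k = 0 \/ k = 1.
  by case: k => [[|[|//]]] h; [left | right]; apply/val_inj.
by case: (ord2 i) => ->; case: (ord2 j) => ->.
Qed.

Lemma rv2P v w : v 0 0 = w 0 0 -> v 0 1 = w 0 1 -> v = w.
Proof.
move=> h0 h1; apply/rowP => i.
have [->|->] // : i = 0 \/ i = 1.
by case: i => [[|[|//]]] h; [left | right]; apply/val_inj.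
Qed.

Lemma mul2E m (A : 'M[F]_(m, 2)) B i j : (A *m B) i j = A i 0 * B 0 j + A i 1 * B 1 j.
Proof.
rewrite mxE !big_ord_recl big_ord0 addr0.
by congr (_ * _ + A i _ * B _ _); apply/val_inj.
Qed.

Lemma tr2E A : \tr A = A 0 0 + A 1 1.
Proof.
rewrite /mxtrace !big_ord_recl big_ord0 addr0.
by congr (_ + A _ _); apply/val_inj.
Qed.

Lemma det2E A : \det A = A 0 0 * A 1 1 - A 0 1 * A 1 0.
Proof.
rewrite (expand_det_row _ 0) !big_ord_recl big_ord0 /cofactor !det_mx11 !mxE /=.
rewrite expr0 mul1r addr0 expr1 mulN1r mulrN; congr (_ * A _ _ - A _ _ * A _ _); exact/val_inj.
Qed.

Definition mx2 a b c d : 'M[F]_2 :=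
  \matrix_(i, j) if i == 0 then (if j == 0 then a else b) else (if j == 0 then c else d).

Lemma mx2E a b c d : (mx2 a b c d 0 0 = a) * (mx2 a b c d 0 1 = b) *
  (mx2 a b c d 1 0 = c) * (mx2 a b c d 1 1 = d).
Proof. by rewrite !mxE. Qed.

Lemma scalar2E a : ((a%:M : 'M[F]_2) 0 0 = a) * ((a%:M : 'M[F]_2) 0 1 = 0) *
  ((a%:M : 'M[F]_2) 1 0 = 0) * ((a%:M : 'M[F]_2) 1 1 = a).
Proof. by rewrite !mxE. Qed.

Lemma addmxE m (A B : 'M[F]_(m, 2)) i j : (A + B) i j = A i j + B i j.
Proof. by rewrite mxE. Qed.
Lemma oppmxE m (A : 'M[F]_(m, 2)) i j : (- A) i j = - A i j.
Proof. by rewrite mxE. Qed.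
Lemma scalemxE m a (A : 'M[F]_(m, 2)) i j : (a *: A) i j = a * A i j.
Proof. by rewrite mxE. Qed.

Definition lin2E := (addmxE, oppmxE, scalemxE, mx2E, scalar2E, mul2E, tr2E, det2E).

End Matrices2.

Ltac mx2_ring := first [apply: mx2P | apply: rv2P | idtac]; rewrite ?lin2E; ring.

Section Matrices2Theory.
Local Open Scope ring_scope.
Variable F : fieldType.
Implicit Types (A B : 'M[F]_2) (v w : 'rV[F]_2) (a b c d : F).

Lemma Cayley_Hamilton2 A : A *m A = \tr A *: A - (\det A)%:M.
Proof. mx2_ring. Qed.

Lemma mxtrace_linear2 A a b : \tr (a%:M + b *: A) = 2 * a + b * \tr A.
Proof. mx2_ring. Qed.

Lemma det_linear2 A a b : \det (a%:M + b *: A) = a ^+ 2 + a * b * \tr A + b ^+ 2 * \det A.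
Proof. mx2_ring. Qed.

Lemma mul_linear2 A a b c d : (a%:M + b *: A) *m (c%:M + d *: A) =
  (a * c - b * d * \det A)%:M + (a * d + b * c + b * d * \tr A) *: A.
Proof. mx2_ring. Qed.

Lemma linear2_inj A a b c d : ~~ is_scalar_mx A ->
  a%:M + b *: A = c%:M + d *: A -> a = c /\ b = d.
Proof.
move=> nsA eqA; have bd : b = d.
  apply/eqP; rewrite -subr_eq0; apply: contraNT nsA => nz.
  apply/is_scalar_mxP; exists ((c - a) / (b - d)).
  apply/matrixP => i j; move/matrixP/(_ i j): eqA; rewrite !mxE => e.
  apply: (mulfI nz); rewrite mulrnAr [X in _ = X *+ _]mulrC divfK //.
  have -> : (b - d) * A i j = (a *+ (i == j) + b * A i j) - a *+ (i == j) - d * A i j by ring.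
  rewrite e mulrnBl; ring.
split=> //; move: eqA; rewrite bd => /addIr /matrixP /(_ 0 0).
by rewrite !scalar2E.
Qed.

(** Since [A] is not scalar, one of [A 0 1], [A 1 0], [A 1 1 - A 0 0] is nonzero; dividing the
    corresponding entry of [B] by it gives [b], and the commutation equations yield the other
    entries. *)
Lemma comm_linear2 A B : ~~ is_scalar_mx A -> A *m B = B *m A ->
  exists a b, B = a%:M + b *: A.
Proof.
move=> nsA /matrixP cAB.
have e00 := cAB 0 0; have e01 := cAB 0 1; have e10 := cAB 1 0.
rewrite !mul2E in e00 e01 e10.
have [A01 | A01] := eqVneq (A 0 1) 0; last first.
  exists (B 0 0 - B 0 1 / A 0 1 * A 0 0), (B 0 1 / A 0 1).
  have A10: B 1 0 = B 0 1 / A 0 1 * A 1 0.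
    apply: (mulfI A01); rewrite mulrA mulrCA mulfV ?mulr1 // .
    by apply: (addrI (A 0 0 * B 0 0)); rewrite e00; ring.
  have A11 : (B 1 1 - B 0 0) = B 0 1 / A 0 1 * (A 1 1 - A 0 0).
    apply: (mulfI A01); rewrite mulrA mulrCA mulfV ?mulr1 // .
    have -> : A 0 1 * (B 1 1 - B 0 0) = (A 0 0 * B 0 1 + A 0 1 * B 1 1) - A 0 0 * B 0 1 - A 0 1 *
      B 0 0 by ring.
    rewrite e01; ring.
  apply: mx2P; rewrite !lin2E; first ring.
  - by rewrite add0r divfK.
  - by rewrite add0r.
  - by rewrite -[LHS](subrK (B 0 0)) A11; ring.
have [A10 | A10] := eqVneq (A 1 0) 0; last first.
  exists (B 0 0 - B 1 0 / A 1 0 * A 0 0), (B 1 0 / A 1 0).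
  have A0: B 0 1 = B 1 0 / A 1 0 * A 0 1.
    apply: (mulfI A10); rewrite mulrA mulrCA mulfV ?mulr1 // .
    apply: (addrI (A 0 0 * B 0 0)).
    have -> : A 0 0 * B 0 0 + B 1 0 * A 0 1 = A 0 0 * B 0 0 + A 0 1 * B 1 0 by ring.
    by rewrite e00; ring.
  have A11 : (B 1 1 - B 0 0) = B 1 0 / A 1 0 * (A 1 1 - A 0 0).
    apply: (mulfI A10); rewrite mulrA mulrCA mulfV ?mulr1 // .
    have -> : A 1 0 * (B 1 1 - B 0 0) = (B 1 0 * A 0 0 + B 1 1 * A 1 0) - A 1 0 * B 0 0 - B 1 0 *
      A 0 0 by ring.
    rewrite -e10; ring.
  apply: mx2P; rewrite !lin2E; first ring.
  - by rewrite add0r.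
  - by rewrite add0r divfK.
  - by rewrite -[LHS](subrK (B 0 0)) A11; ring.
have A11 : A 1 1 - A 0 0 != 0.
  apply: contraNneq nsA => /eqP; rewrite subr_eq0 => /eqP h.
  by apply/is_scalar_mxP; exists (A 0 0); apply: mx2P; rewrite !lin2E.
have k := mulfI A11.
have B01 : B 0 1 = 0.
  apply: k; rewrite mulr0 mulrBl; apply/eqP; rewrite subr_eq0; apply/eqP.
  by move: e01; rewrite A01 mul0r mulr0 addr0 add0r mulrC => ->; rewrite mulrC.
have B10 : B 1 0 = 0.
  apply: k; rewrite mulr0 mulrBl; apply/eqP; rewrite subr_eq0; apply/eqP.
  by move: e10; rewrite A10 mul0r mulr0 addr0 add0r [RHS]mulrC => ->.
exists (B 0 0 - (B 1 1 - B 0 0) / (A 1 1 - A 0 0) * A 0 0), ((B 1 1 - B 0 0) / (A 1 1 - A 0 0)).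
apply: mx2P; rewrite !lin2E ?A01 ?A10 ?B01 ?B10; try ring.
have e : B 1 1 - B 0 0 = (B 1 1 - B 0 0) / (A 1 1 - A 0 0) * (A 1 1 - A 0 0) by rewrite divfK.
rewrite -[LHS](subrK (B 0 0)) {1}e; ring.
Qed.

End Matrices2Theory.

(** * Passing to the quotient by the centre *)

Section CentralQuotient.
Local Open Scope group_scope.
Variables (gT : finGroupType) (G : {group gT}).
Implicit Types (H : {group gT}) (x y : gT).

Lemma solvable_quotient_center H : H \subset G -> solvable (H / 'Z(G)) = solvable H.
Proof.
move=> sHG; apply/idP/idP => [solHZ | /quotient_sol -> //].
have nZH : H \subset 'N('Z(G)) by apply: subset_trans sHG (gFnorm _ _).
(* [H] need not contain the centre, so solvability is lifted to the product of [H] with the centre,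
   an extension by an abelian group. *)
have nsZ : 'Z(G) <| 'Z(G) <*> H by rewrite /normal joing_subl join_subG normG nZH.
apply: (solvableS (joing_subr 'Z(G) H)).
by rewrite (series_sol nsZ) quotientYidl // solHZ andbT abelian_sol ?center_abelian.
Qed.

Lemma solvable_gen_coset x y : x \in G -> y \in G ->
  solvable <<[set coset 'Z(G) x; coset 'Z(G) y]>> = solvable <<[set x; y]>>.
Proof.
move=> Gx Gy; have sxyG : [set x; y] \subset G by rewrite subUset !sub1set Gx.
have nZ : [set x; y] \subset 'N('Z(G)) by apply: subset_trans sxyG (gFnorm _ _).
rewrite -(@solvable_quotient_center <<[set x; y]>>%G) ?gen_subG //= quotient_gen //.
congr (solvable <<_>>); rewrite /quotient morphimU.
by rewrite !morphim_set1 ?(subsetP nZ) ?set21 ?set22.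
Qed.

Lemma mem_solvabilizer_coset x y : x \in G -> y \in G ->
  (coset 'Z(G) y \in solvabilizer (G / 'Z(G)) (coset 'Z(G) x)) = (y \in solvabilizer G x).
Proof. by move=> Gx Gy; rewrite !inE solvable_gen_coset // Gy mem_quotient. Qed.

Lemma solvabilizer_coset x : x \in G ->
  solvabilizer (G / 'Z(G)) (coset 'Z(G) x) = coset 'Z(G) @: solvabilizer G x.
Proof.
move=> Gx; apply/setP=> yb; apply/idP/imsetP => [Syb | [y Sy ->]].
  have /morphimP[y Ny Gy Dy]: yb \in G / 'Z(G) by move: Syb; rewrite inE => /andP[].
  by exists y => //; rewrite -mem_solvabilizer_coset // -Dy.
by rewrite mem_solvabilizer_coset //; case/setIdP: Sy.
Qed.

(** A solvabilizer is a union of cosets of the centre, so it is determined by its image in the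
    quotient. *)
Lemma card_Solv_quotient_center : #|Solv (G / 'Z(G))| = #|Solv G|.
Proof.
have -> : Solv (G / 'Z(G)) = [set coset 'Z(G) @: A | A : {set gT} in Solv G].
  apply/setP => B; apply/imsetP/imsetP => [[xb /morphimP[x Nx Gx ->] ->] | [A /imsetP[x Gx ->] ->]].
    by exists (solvabilizer G x); [apply: imset_f | rewrite solvabilizer_coset].
  by exists (coset 'Z(G) x); [apply: mem_quotient | rewrite solvabilizer_coset].
rewrite card_in_imset // => _ _ /imsetP[x Gx ->] /imsetP[x' Gx' ->].
rewrite -!solvabilizer_coset // => eqS.
apply/setP => y; case Gy: (y \in G); last by rewrite !inE Gy.
by rewrite -!mem_solvabilizer_coset // eqS.
Qed.

End CentralQuotient.

(** On [A] the map [g] factors through [f]; [h] is the factor, with values in [option T3] so as to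
    be defined off [f @: A]. Applied both ways, this equates the number of solvabilizers of a type
    with a number of centralizers. *)
Lemma leq_card_imset_fibre (T1 T2 T3 : finType) (A : {set T1}) (f : T1 -> T2) (g : T1 -> T3) :
  {in A &, forall x y, f x = f y -> g x = g y} -> #|g @: A| <= #|f @: A|.
Proof.
move=> fg; pose h (b : T2) := if [pick x in A | f x == b] is Some x then Some (g x) else None.
rewrite -(card_imset (mem (g @: A)) (fun x y (e : Some x = Some y) => Some_inj e)).
apply: leq_trans (leq_imset_card h (f @: A)); apply/subset_leq_card/subsetP=> _ /imsetP[_
  /imsetP[x Ax ->] ->].
apply/imsetP; exists (f x); first exact: imset_f.
by rewrite /h; case: pickP => [y /andP[Ay /eqP /fg ->] // | /(_ x)]; rewrite Ax eqxx.
Qed.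

Lemma card_imsetU_disjoint (T1 T2 : finType) (A B : {set T1}) (f : T1 -> T2) :
  {in A & B, forall x y, f x != f y} -> #|f @: (A :|: B)| = (#|f @: A| + #|f @: B|)%N.
Proof.
move=> fAB; rewrite imsetU cardsU (_ : _ :&: _ = set0) ?cards0 ?subn0 //.
apply/setP=> y; rewrite in_set0; apply/negP=> /setIP[/imsetP[x Ax ->] /imsetP[z Bz] /eqP].
by apply/negP/fAB.
Qed.

Lemma solvable_commg (gT : finGroupType) (G A : {group gT}) : abelian A ->
  {in G &, forall x y, [~ x, y]%g \in A} -> solvable G.
Proof.
move=> abA comA; have sGA : (G^`(1) \subset A)%g.
  by rewrite derg1 gen_subG; apply/subsetP=> _ /imset2P[x y Gx Gy ->]; apply: comA.
apply/derivedP; exists 2; apply/trivgP; rewrite /= (dergSn 1).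
by apply: subset_trans (commgSS sGA sGA) _; apply/trivgP/commG1P.
Qed.

(** * Solvable subgroups of commutative-transitive central extensions *)

Section KleinFour.
Local Open Scope group_scope.
Variables (gT : finGroupType) (a b x : gT).
Hypotheses (cab : commute a b) (aa : a * a = 1) (bb : b * b = 1).
Hypotheses (na : a != 1) (nb : b != 1) (nab : a != b).

(** Conjugation by [x] permutes the three involutions of the Klein four-group: either its square is
    trivial, or it is a 3-cycle and fixes no involution. *)
Lemma Klein_four_conj : a ^ x \in [:: 1; a; b; a * b] -> b ^ x \in [:: 1; a; b; a * b] ->
  (a ^ (x ^+ 2) = a /\ b ^ (x ^+ 2) = b) \/
  [/\ a ^ (x ^+ 3) = a, b ^ (x ^+ 3) = b & [/\ a ^ x != a, b ^ x != b & (a * b) ^ x != a * b]].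
Proof.
have nax : a ^ x != 1 by rewrite conjg_eq1.
have nbx : b ^ x != 1 by rewrite conjg_eq1.
have nabx : a ^ x != b ^ x by rewrite (inj_eq (conjg_inj x)).
have aab : a * (a * b) = b by rewrite mulgA aa mul1g.
have abb : a * b * b = a by rewrite -mulgA bb mulg1.
have bab : b * (a * b) = a by rewrite cab mulgA bb mul1g.
have aba : a * b * a = b by rewrite -mulgA -cab.
have nba : b != a by rewrite eq_sym.
have naab : a != a * b by rewrite -{1}[a]mulg1 (inj_eq (mulgI a)) eq_sym.
have nbab : b != a * b by rewrite -{1}[b]mul1g (inj_eq (mulIg b)) eq_sym.
have abx : (a * b) ^ x = a ^ x * b ^ x by rewrite conjMg.
rewrite -[x ^+ 3]/(x * (x * x)) -[x ^+ 2]/(x * x) !inE (negPf nax) (negPf nbx) /= => /or3P[]/eqP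
  xa /or3P[]/eqP xb;
  move: nabx; rewrite xa xb ?eqxx //= => _;
  (try by left; rewrite !conjgM ?(abx, xa, xb, aab, abb, bab, aba));
  right; rewrite !conjgM !(abx, xa, xb, aab, abb, bab, aba); split=> //; split=> //;
    by rewrite eq_sym.
Qed.

End KleinFour.

Section CommutativeTransitive.
Local Open Scope group_scope.
Variables (gT : finGroupType) (G : {group gT}) (z : gT).
Hypothesis centerE : 'Z(G) = [set 1; z].
Hypothesis cent1_abelian : {in G :\: 'Z(G), forall a, abelian 'C_G[a]}.
Implicit Types (H D : {group gT}) (a b c d x y : gT).
Local Notation Z := 'Z(G).

Lemma commute_trans a b c : a \in G :\: Z -> b \in G -> c \in G ->
  commute a b -> commute a c -> commute b c.
Proof.
move=> nca Gb Gc cab cac; have := cent1_abelian nca.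
move/centsP/(_ b _ c); apply; first by rewrite in_setI Gb; apply/cent1P.
by rewrite in_setI Gc; apply/cent1P.
Qed.

Lemma cent1_eq a b : a \in G :\: Z -> b \in G :\: Z -> commute a b -> 'C_G[a] = 'C_G[b].
Proof.
move=> nca ncb cab; have [Ga _] := setDP nca; have [Gb _] := setDP ncb.
apply/setP => c; rewrite !in_setI; case Gc: (c \in G) => //=.
apply/cent1P/cent1P => h; first by apply: commute_sym; apply: commute_trans nca _ _ _ _.
by apply: commute_sym; apply: commute_trans ncb _ _ _ _ => //; apply: commute_sym.
Qed.

Lemma cent1_eqP a b : a \in G :\: Z -> b \in G :\: Z ->
  reflect (commute a b) ('C_G[a] == 'C_G[b]).
Proof.
move=> nca ncb; apply: (iffP eqP) => [eqC |]; last exact: cent1_eq.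
have [Gb _] := setDP ncb; suff: b \in 'C_G[a] by rewrite in_setI Gb => /cent1P/commute_sym.
by rewrite eqC in_setI Gb; apply/cent1P.
Qed.

Lemma memZ x : (x \in Z) = (x == 1) || (x == z). Proof. by rewrite centerE !inE. Qed.

Lemma cz x : x \in G -> commute z x.
Proof. by have: z \in Z; [rewrite memZ eqxx orbT | case/centerP=> _; apply]. Qed.

Lemma z2 : z * z = 1.
Proof.
have Zz : z \in Z by rewrite memZ eqxx orbT.
have: z * z \in Z by rewrite groupM.
rewrite memZ => /orP[/eqP // | /eqP h].
by have -> : z = 1 by [apply: (mulgI z); rewrite h mulg1]; rewrite mulg1.
Qed.

(* A group of this kind is the full preimage in G of a Klein four-subgroup of G / Z(G). *)
Definition quaternion_frame D := [/\ D \subset G, ~~ abelian D & D^`(1) \subset Z].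

Lemma solvable_structure H : H \subset G -> solvable H -> ~~ (H \subset Z) ->
  (exists2 a, a \in G :\: Z & H \subset 'N('C_G[a])) \/
  (exists2 D, quaternion_frame D & H \subset 'N(D)).
Proof.
move=> sHG /derivedP[n Hn1] nHZ.
have exn : exists n, H^`(n) \subset Z by exists n; rewrite Hn1 sub1G.
case: (ex_minnP exn) => -[|m] sDZ minm; first by rewrite derg0 (negPf nHZ) in sDZ.
(* [m.+1] is the least index with a central derived subgroup, so [D] is not central while its own
   derived subgroup is. *)
pose D := (H^`(m))%G; have nDZ : ~~ (D \subset Z) by apply/negP=> /minm; rewrite ltnn.
have sDG : D \subset G by apply: subset_trans (der_sub _ _) sHG.
have nDH : H \subset 'N(D) by apply: gFnorm.
have [abD | nabD] := boolP (abelian D); last by right; exists D => //; split=> //;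
  rewrite derg1 -dergSn.
left; case/subsetPn: nDZ => a Da nZa; have Ga := subsetP sDG a Da.
have nca : a \in G :\: Z by rewrite inE nZa.
(* By transitivity C(a) centralizes the whole abelian group [D], so it is the centralizer of a group
   normalized by [H]. *)
exists a => //; suff -> : 'C_G[a] = 'C_G(D) by rewrite normsI ?norms_cent // (subset_trans sHG)
  ?normG.
apply/eqP; rewrite eqEsubset; apply/andP; split; last by rewrite setIS // -cent_set1 centS ?sub1set.
rewrite subsetI subsetIl /=; apply/centsP => c /setIP[Gc /cent1P cac] d Dd.
apply: (commute_trans nca) => //; first exact: (subsetP sDG).
by apply: (centsP abD).
Qed.

Lemma frame_gens D : quaternion_frame D ->
  exists a b, [/\ a \in D, b \in D & ~ commute a b].
Proof.
case=> _ nabD _; case/subsetPn: nabD => a Da nCa.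
have [b Db nab] : exists2 b, b \in D & b \notin 'C[a].
  by apply/subsetPn; apply: contra nCa; rewrite -sub_cent1.
by exists a, b; split=> // /commute_sym/cent1P; apply/negP.
Qed.

Lemma commgZ x y : [~ x, y] \in Z -> y ^ x = y \/ y ^ x = y * z.
Proof.
rewrite -groupV invg_comm memZ conjg_mulR => /orP[]/eqP->; last by right.
by left; rewrite mulg1.
Qed.

Lemma commg_frame D x y : quaternion_frame D -> x \in D -> y \in D -> [~ x, y] \in Z.
Proof. by case=> _ _ /subsetP sDZ Dx Dy; apply: sDZ; rewrite derg1 mem_commg. Qed.

Lemma frame_coset D a b x : quaternion_frame D -> a \in D -> b \in D ->
  ~ commute a b -> x \in G -> [~ x, a] \in Z -> [~ x, b] \in Z ->
  exists2 e, e \in [:: 1; a; b; a * b] & x * e \in Z.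
Proof.
move=> frD Da Db nab Gx xaZ xbZ; have [sDG _ _] := frD.
have Ga := subsetP sDG a Da; have Gb := subsetP sDG b Db.
have nca : a \in G :\: Z.
  by rewrite inE Ga andbT; apply/negP=> /centerP[_ /(_ b Gb)].
have ncb : b \in G :\: Z.
  by rewrite inE Gb andbT; apply/negP=> /centerP[_ /(_ a Ga)] /commute_sym.
have zJ g : g \in G -> z ^ g = z by move=> Gg; apply/conjg_fixP/commgP/cz.
have [eab eba] : a ^ b = a * z /\ b ^ a = b * z.
  have [] := commgZ (commg_frame frD Db Da); first by move/conjg_fixP/commgP.
  have [] := commgZ (commg_frame frD Da Db); last by [].
  by move/conjg_fixP/commgP/commute_sym.
have endZ e : e \in G -> a ^ (x * e) = a -> b ^ (x * e) = b -> x * e \in Z.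
  move=> Ge /conjg_fixP/commgP/commute_sym ca /conjg_fixP/commgP/commute_sym cb.
  apply/negPn/negP => nZ; apply: nab.
  by apply: (@commute_trans (x * e)); rewrite // inE nZ groupM.
have zzK g : g * z * z = g by rewrite -mulgA z2 mulg1.
have gg (g : gT) : g ^ g = g by rewrite conjgE mulKg.
have gzJ g h : h \in G -> (g * z) ^ h = g ^ h * z by move=> Gh; rewrite conjMg (zJ h).
have [xa | xa] := commgZ xaZ; have [xb | xb] := commgZ xbZ.
- by exists 1; [rewrite !inE eqxx | apply: endZ; rewrite // mulg1].
- exists a; [by rewrite !inE eqxx orbT | apply: endZ; rewrite // conjgM].
    by rewrite xa gg.
  by rewrite xb gzJ // eba zzK.
- exists b; [by rewrite !inE eqxx !orbT | apply: endZ; rewrite // conjgM].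
    by rewrite xa gzJ // eab zzK.
  by rewrite xb gg.
exists (a * b); [by rewrite !inE eqxx !orbT | apply: endZ]; rewrite ?groupM // mulgA 2!conjgM.
  by rewrite xa gzJ // gg gzJ // eab zzK.
by rewrite xb gzJ // eba zzK gg.
Qed.

Lemma frame_mem D a b x : quaternion_frame D -> a \in D -> b \in D ->
  ~ commute a b -> x \in G -> [~ x, a] \in Z -> [~ x, b] \in Z -> x \in D.
Proof.
move=> frD Da Db nab Gx xaZ xbZ.
have Dz : z \in D.
  have : [~ a, b] \in D by rewrite groupR.
  have := commg_frame frD Da Db.
  by rewrite memZ => /orP[/commgP // | /eqP ->].
have [e De xeZ] := frame_coset frD Da Db nab Gx xaZ xbZ.
have {}De : e \in D by move: De; rewrite !inE => /or4P[]/eqP->; rewrite ?groupM.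
rewrite -(groupMr _ De); move: xeZ; rewrite memZ => /orP[] /eqP-> //.
Qed.

(** Since [a ^ b = a * z], the square of [a] commutes with [b] as well as with [a]; if it were not
    central, transitivity would make [a] and [b] commute. *)
Lemma frame_sqr D a b : quaternion_frame D -> a \in D -> b \in D -> ~ commute a b ->
  a * a \in Z.
Proof.
move=> frD Da Db nab; have [sDG _ _] := frD.
have Ga := subsetP sDG a Da; have Gb := subsetP sDG b Db.
have eab : a ^ b = a * z.
  have [] := commgZ (commg_frame frD Db Da); last by [].
  by move/conjg_fixP/commgP.
have caab : commute (a * a) b.
  apply/commgP/conjg_fixP; rewrite conjMg eab -mulgA [z * _]mulgA cz // -!mulgA z2 mulg1 //.
apply/negPn/negP => nZ; apply: nab.
apply: (@commute_trans (a * a)) => //; first by rewrite inE nZ groupM.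
by apply: commute_sym; apply: commuteM.
Qed.

(** [x] acts on the Klein four-group [D / Z]. If its square acts trivially, then [x ^+ 2] is in [D],
    whose elements have central squares. If it acts as a 3-cycle, the image of [x ^+ 3] is in the
    four-group and fixed by [x], hence trivial. *)
Lemma frame_expg D x : quaternion_frame D -> x \in G -> x \in 'N(D) ->
  x ^+ 3 \in Z \/ (x ^+ 2 \in D /\ x ^+ 4 \in Z).
Proof.
move=> frD Gx Nx; have [sDG _ _] := frD.
have [a [b [Da Db nab]]] := frame_gens frD.
have nba : ~ commute b a by move/commute_sym.
have Ga := subsetP sDG a Da; have Gb := subsetP sDG b Db.
have nZ g : g \in G -> g \in 'N(Z) by apply: subsetP (gFnorm _ _) g.
pose f := coset Z.
have fM g h : g \in G -> h \in G -> f (g * h) = f g * f h by move=> *; rewrite /f morphM ?nZ.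
have f1 g : g \in G -> (f g == 1) = (g \in Z).
  by move=> Gg; apply/eqP/idP => [/(coset_idr (nZ g Gg)) | /coset_id].
have fR g h : g \in G -> h \in G -> ([~ g, h] \in Z) = (f h ^ f g == f h).
  move=> Gg Gh; rewrite -f1 ?groupR // /f morphR ?nZ //.
  by apply/commgP/eqP => [/commute_sym/commgP/conjg_fixP | /conjg_fixP/commgP/commute_sym].
have fX g n : g \in G -> f (g ^+ n) = f g ^+ n by move=> Gg; rewrite /f morphX ?nZ.
have faa : f a * f a = 1 by rewrite -fM //; apply/eqP; rewrite f1;
  [exact: frame_sqr frD Da Db nab | exact: groupM].
have fbb : f b * f b = 1 by rewrite -fM //; apply/eqP; rewrite f1;
  [exact: frame_sqr frD Db Da nba | exact: groupM].
have cfab : commute (f a) (f b).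
  by apply/commgP; rewrite /f -morphR ?nZ //; apply/eqP/coset_id/(commg_frame frD).
have na : f a != 1.
  by rewrite f1 //; apply: contra_notN nab => /centerP[_]; apply.
have nb : f b != 1.
  by rewrite f1 //; apply: contra_notN nba => /centerP[_]; apply.
have nfab : f a != f b.
  apply: contra_notN nab => /eqP eab; have: a * b \in Z by rewrite -f1;
    [rewrite fM // eab fbb | exact: groupM].
  case/centerP=> _ /(_ b Gb) e; apply: (mulIg b); rewrite e; exact/mulgA.
have fV d : d \in D -> f d \in [:: 1; f a; f b; f a * f b].
  move=> Dd; have Gd := subsetP sDG d Dd.
  have [|| e Ve deZ] := frame_coset frD Da Db nab Gd; rewrite ?(commg_frame frD) //.
  have Ge : e \in G by move: Ve; rewrite !inE => /or4P[]/eqP->; rewrite ?groupM.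
  have fee : f e * f e = 1.
    move: Ve; rewrite !inE => /or4P[]/eqP-> //; rewrite ?fM //.
      by rewrite [f 1]morph1 mulg1.
    by rewrite mulgA -(mulgA (f a)) -cfab mulgA faa mul1g fbb.
  have -> : f d = f e.
    by apply: (mulIg (f e)); rewrite fee -fM //; apply/eqP; rewrite f1 //; apply: groupM.
  move: Ve; rewrite !inE => /or4P[]/eqP->; rewrite ?fM // ?eqxx ?orbT //.
  by rewrite [f 1]morph1 eqxx.
have fJ d : d \in D -> f d ^ f x \in [:: 1; f a; f b; f a * f b].
  move=> Dd; have Ddx : d ^ x \in D by rewrite memJ_norm.
  by have := fV _ Ddx; rewrite /f morphJ ?nZ // (subsetP sDG).
have Gxn n : x ^+ n \in G by apply: groupX.
have inD n : f a ^ (f x ^+ n) = f a -> f b ^ (f x ^+ n) = f b -> x ^+ n \in D.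
  move=> ha hb; apply: (frame_mem frD Da Db nab); rewrite // fR // fX // ?ha ?hb //.
have [[x2a x2b] | [x3a x3b [xa xb xab]]] := Klein_four_conj cfab faa fbb na nb nfab (fJ a Da) (fJ
  b Db).
  right; have Dx2 := inD 2 x2a x2b; split=> //.
  rewrite -f1 // (expgM _ 2 2) fX // expgS expg1.
  have := fV _ Dx2; rewrite !inE => /or4P[]/eqP-> //; rewrite ?mulg1 ?faa ?fbb //.
  by rewrite mulgA -(mulgA (f a)) -cfab mulgA faa mul1g fbb.
left; have Dx3 := inD 3 x3a x3b; rewrite -f1 //.
have cx3 : f (x ^+ 3) ^ f x = f (x ^+ 3).
  by rewrite fX //; apply/conjg_fixP/commgP/commute_sym/commuteX.
have := fV _ Dx3; rewrite !inE => /or4P[]/eqP e; first by rewrite e.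
- by rewrite -e cx3 eqxx in xa.
- by rewrite -e cx3 eqxx in xb.
by rewrite -e cx3 eqxx in xab.
Qed.

End CommutativeTransitive.

(** * Eigenvectors, transvections and anticommuting matrices *)

Section Independent.
Local Open Scope ring_scope.
Variable F : fieldType.
Implicit Types (A B : 'M[F]_2) (v w : 'rV[F]_2).

Lemma mulmx_independent v w A B : v != 0 -> ~~ (w <= v)%MS ->
  v *m A = v *m B -> w *m A = w *m B -> A = B.
Proof.
move=> nzv nwv vAB wAB.
(* This is the determinant of the matrix with rows [v] and [w]; Cramer's rule then shows that a
   matrix killing both vectors is 0. *)
have d_nz : v 0 0 * w 0 1 - v 0 1 * w 0 0 != 0.
  apply: contraNneq nwv => /eqP; rewrite subr_eq0 => /eqP d0; apply/sub_rVP.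
  have [v0 | v0] := eqVneq (v 0 0) 0; last first.
    exists (w 0 0 / v 0 0); apply: rv2P; rewrite ?lin2E ?divfK //.
    by apply: (mulfI v0); rewrite d0; field.
  have v1 : v 0 1 != 0.
    by apply: contraNneq nzv => v1; apply/eqP/rv2P; rewrite ?v0 ?v1 mxE.
  exists (w 0 1 / v 0 1); apply: rv2P; rewrite ?lin2E ?divfK //.
  apply: (mulfI v1); rewrite -d0 v0; ring.
suff gen (C : 'M[F]_2) : v *m C = 0 -> w *m C = 0 -> C = 0.
  by apply/eqP; rewrite -subr_eq0; apply/eqP/gen; rewrite mulmxBr ?vAB ?wAB subrr.
move=> vC wC; have C0 j : C 0 j = 0 /\ C 1 j = 0.
  have := congr1 (fun M : 'rV_2 => M 0 j) vC; have := congr1 (fun M : 'rV_2 => M 0 j) wC.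
  rewrite !mul2E ![(0 : 'rV_2) _ _]mxE => ew ev; split; apply: (mulfI d_nz); rewrite mulr0.
    have -> : (v 0 0 * w 0 1 - v 0 1 * w 0 0) * C 0 j = w 0 1 * (v 0 0 * C 0 j + v 0 1 * C 1 j) -
      v 0 1 * (w 0 0 * C 0 j + w 0 1 * C 1 j) by ring.
    by rewrite ew ev; ring.
  have -> : (v 0 0 * w 0 1 - v 0 1 * w 0 0) * C 1 j = v 0 0 * (w 0 0 * C 0 j + w 0 1 * C 1 j) - w
    0 0 * (v 0 0 * C 0 j + v 0 1 * C 1 j) by ring.
  by rewrite ew ev; ring.
by apply: mx2P; rewrite ?(C0 _).1 ?(C0 _).2 mxE.
Qed.

Lemma eigenvalue2 v A l : v != 0 -> v *m A = l *: v -> l ^+ 2 - \tr A * l + \det A = 0.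
Proof.
move=> nzv vA; apply/eqP; apply: contraNT nzv => nz.
suff: (l ^+ 2 - \tr A * l + \det A) *: v == 0 by rewrite scaler_eq0 (negPf nz).
have := congr1 (mulmx v) (Cayley_Hamilton2 A).
rewrite mulmxBr mulmxA vA -scalemxAl vA scalerA mul_mx_scalar -scalemxAr vA scalerA => e.
by rewrite scalerDl scalerBl expr2 e -addrA [- _ + _]addrC addrA subrK subrr.
Qed.

(** By Cayley-Hamilton every row of [A - (\tr A - l)] is an eigenvector for [l] or 0, and some row
    is nonzero because [A] is not scalar. *)
Lemma exists_eigenvector2 A l : ~~ is_scalar_mx A -> l ^+ 2 - \tr A * l + \det A = 0 ->
  exists2 v : 'rV[F]_2, v != 0 & v *m A = l *: v.
Proof.
move=> nsA el; pose M := A - (\tr A - l)%:M.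
have MA : M *m A = l *: M.
  have -> : M *m A = l *: M - (l ^+ 2 - \tr A * l + \det A)%:M by rewrite /M; mx2_ring.
  by rewrite el raddf0 subr0.
have nzM : M != 0.
  by apply: contraNneq nsA => /eqP; rewrite subr_eq0 => /eqP ->; apply: scalar_mx_is_scalar.
have [i nzi] : exists i, row i M != 0.
  apply/existsP; apply: contraNT nzM; rewrite negb_exists => /forallP z.
  by apply/eqP/row_matrixP => i; rewrite row0; apply/eqP/negPn/z.
by exists (row i M); rewrite // -row_mul MA; apply/rowP => j; rewrite !mxE.
Qed.

(** The column [(- v 0 1, v 0 0)] times the row [v]: a nilpotent matrix killing [v], so that
    [1 + k * transvector v] runs through the transvections fixing [v]. *)
Definition transvector v : 'M[F]_2 :=
  mx2 (- (v 0 0 * v 0 1)) (- (v 0 1 ^+ 2)) (v 0 0 ^+ 2) (v 0 0 * v 0 1).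

Lemma fix_vector_transvector v A : v != 0 -> \det A = 1 -> v *m A = v ->
  exists k, A = 1%:M + k *: transvector v.
Proof.
move=> nzv dA vA; have t2 : \tr A = 2.
  have := @eigenvalue2 v A 1 nzv; rewrite scale1r vA dA => /(_ erefl) /eqP.
  by rewrite expr1n mulr1 addrAC subr_eq0 eq_sym => /eqP.
have e0 := congr1 (fun w : 'rV[F]_2 => w 0 0) vA; have e1 := congr1 (fun w : 'rV[F]_2 => w 0 1) vA.
rewrite /= !mul2E in e0 e1; rewrite tr2E in t2.
have d11 : A 1 1 = 2 - A 0 0 by rewrite -t2; ring.
have f0 : v 0 0 * (A 0 0 - 1) = - (v 0 1 * A 1 0).
  by rewrite mulrBr mulr1 -{2}e0; ring.
have f1 : v 0 0 * A 0 1 = v 0 1 * (A 0 0 - 1).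
  by rewrite -[LHS](addrK (v 0 1 * A 1 1)) e1 d11; ring.
have [v0 | v0] := eqVneq (v 0 0) 0; last first.
  exists (A 1 0 / v 0 0 ^+ 2); apply: mx2P; rewrite /transvector ?lin2E.
  - by apply: (mulfI v0); rewrite -[A 0 0](subrK 1) mulrDr f0; field.
  - by apply: (mulfI v0); apply: (mulfI v0); rewrite f1 mulrCA f0; field.
  - by field.
  rewrite d11; have -> : 2 - A 0 0 = 1 - (A 0 0 - 1) by ring.
  by apply: (mulfI v0); rewrite mulrBr f0; field.
have v1 : v 0 1 != 0.
  by apply: contraNneq nzv => v1; apply/eqP/rv2P; rewrite ?v0 ?v1 mxE.
have A10 : A 1 0 = 0.
  by apply: (mulfI v1); apply: oppr_inj; rewrite -f0 v0; ring.
have A00 : A 0 0 = 1.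
  by apply/eqP; rewrite -subr_eq0; apply/eqP/(mulfI v1); rewrite -f1 v0 mul0r mulr0.
exists (- A 0 1 / v 0 1 ^+ 2); apply: mx2P; rewrite /transvector ?lin2E ?v0 ?d11 ?A00 ?A10;
  by field.
Qed.

(** Eliminating [a] between trace and determinant leaves [(b ^+ 2 - 1) * (4 - t ^+ 2) = 0]. The
    second solution is the inverse of [A]: in F[A] an element of determinant 1 and the trace of [A]
    is [A] or its inverse. *)
Lemma linear2_same_trace A (a b : F) : 2 != 0 :> F -> \det A = 1 -> \tr A ^+ 2 != 4 ->
  \det (a%:M + b *: A) = 1 -> \tr (a%:M + b *: A) = \tr A ->
  a%:M + b *: A = A \/ a%:M + b *: A = (\tr A)%:M - A.
Proof.
move=> nz2 dA nt4; rewrite det_linear2 mxtrace_linear2 dA mulr1; set t := \tr A in nt4 * => dB tB.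
have a2 : 2 * a = t - b * t by rewrite -{1}tB addrK.
have : (b ^+ 2 - 1) * (4 - t ^+ 2) = 0.
  have -> : (b ^+ 2 - 1) * (4 - t ^+ 2) = (t - b * t) ^+ 2 + 2 * (t - b * t) * b * t + 4 * b ^+ 2
    - 4 by ring.
  rewrite -a2; have -> : (2 * a) ^+ 2 + 2 * (2 * a) * b * t + 4 * b ^+ 2 - 4 = 4 * (a ^+ 2 + a * b
    * t + b ^+ 2) - 4 by ring.
  by rewrite dB mulr1 subrr.
move/eqP; rewrite mulf_eq0 [4 - _ == 0]subr_eq0 [4 == _]eq_sym (negPf nt4) orbF subr_eq0
  -[1](expr1n _ 2) eqf_sqr.
case/orP=> /eqP b1; rewrite b1 in a2 *; [left | right].
  have -> : a = 0 by apply: (mulfI nz2); rewrite a2; ring.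
  by rewrite raddf0 add0r scale1r.
have -> : a = t by apply: (mulfI nz2); rewrite a2; ring.
by rewrite scaleN1r.
Qed.

Lemma det_add2 A B : \det (A + B) = \det A + \det B + \tr A * \tr B - \tr (A *m B).
Proof. by rewrite !lin2E; ring. Qed.

(** An invertible matrix of trace 0 orthogonal to [A] for the trace form, chosen according to which
    entry keeps [A] from being scalar. Conjugation by it sends [A] to its adjugate; its determinant
    is adjusted later by a factor from F[A]. *)
Lemma exists_anticommuting A : ~~ is_scalar_mx A -> exists B : 'M[F]_2,
  [/\ \tr B = 0, \tr (A *m B) = 0, \det B != 0 & A *m B = B *m ((\tr A)%:M - A)].
Proof.
move=> nsA; have [A01|A01] := eqVneq (A 0 1) 0; last first.
  exists (mx2 (A 0 1) 0 (A 1 1 - A 0 0) (- A 0 1)); split; try by mx2_ring.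
  by rewrite !lin2E mul0r subr0 mulrN oppr_eq0 mulf_neq0.
have [A10|A10] := eqVneq (A 1 0) 0; last first.
  exists (mx2 (A 1 0) (A 1 1 - A 0 0) 0 (- A 1 0)); split; try by mx2_ring.
  by rewrite !lin2E mulr0 subr0 mulrN oppr_eq0 mulf_neq0.
exists (mx2 0 1 1 0); split; rewrite ?lin2E ?A01 ?A10; try ring.
  by rewrite mulr0 mulr1 sub0r oppr_eq0 oner_neq0.
by apply: mx2P; rewrite !lin2E ?A01 ?A10; ring.
Qed.

End Independent.

(** * Binary quadratic forms over a finite field *)

Section FiniteForms.
Local Open Scope ring_scope.
Variable F : finFieldType.
Hypothesis two_neq0 : 2 != 0 :> F.

Lemma card_sqrt_le2 (q : F) : (#|[set x : F | x ^+ 2 == q]| <= 2)%N.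
Proof.
have [->|[y]] := set_0Vmem [set x : F | x ^+ 2 == q]; first by rewrite cards0.
rewrite inE => /eqP <-; apply: leq_trans (_ : #|[set y; - y]| <= 2)%N.
  by apply/subset_leq_card/subsetP=> x; rewrite !inE eqf_sqr.
by rewrite cards2; case: (_ != _).
Qed.

(** The fibres of squaring have at most 2 elements and the fibre of 0 has only one, whence the
    strict inequality. *)
Lemma card_squares : (#|F| < 2 * #|[set x ^+ 2 | x in F]|)%N.
Proof.
set Q := [set _ | _ in _]; have Q0 : 0 \in Q by apply/imsetP; exists 0; rewrite ?expr0n.
have -> : #|F| = (\sum_(q in Q) #|[set x : F | x ^+ 2 == q]|)%N.
  rewrite -sum1_card (partition_big_imset (fun x : F => x ^+ 2)) /=.
  by apply: eq_bigr => q _; rewrite -sum1_card; apply: eq_bigl => x; rewrite inE.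
rewrite (bigD1 0) //= (cardsD1 0 Q) Q0 mulnDr.
have -> : [set x : F | x ^+ 2 == 0] = [set 0] by apply/setP=> x; rewrite !inE sqrf_eq0.
rewrite cards1 muln1 add1n; apply: (@leq_add 2 _ 2) => //.
rewrite mulnC -sum_nat_const (eq_bigl (mem (Q :\ 0))); last first.
  by move=> q; rewrite /= !inE andbC.
by apply: leq_sum => q _; apply: card_sqrt_le2.
Qed.

(** The sets of all [x ^+ 2] and of all [c + d * y ^+ 2] both contain more than half of the field,
    so they meet. *)
Lemma binary_form_repr (d c : F) : d != 0 -> exists x y, x ^+ 2 - d * y ^+ 2 = c.
Proof.
move=> nzd; set Q := [set x ^+ 2 | x in F]; pose R := [set c + d * q | q in Q].
have cR : #|R| = #|Q| by rewrite card_imset // => x y /addrI /(mulfI nzd).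
have [/eqP QR0 | [z /setIP[/imsetP[x _ ->] /imsetP[_ /imsetP[y _ ->] e]]]] := set_0Vmem (Q :&: R).
  have := card_squares; rewrite -/Q mul2n -addnn -{2}cR -cardsUI (eqP QR0) cards0 addn0.
  by rewrite ltnNge max_card.
by exists x, y; rewrite e addrK.
Qed.

(** The form is the determinant of [a + b A] for [A] of determinant 1 and trace [t]; completing the
    square makes it diagonal, with [d = t ^+ 2 - 4]. *)
Lemma norm_form_repr (t c : F) : t ^+ 2 != 4 -> exists a b, a ^+ 2 + a * b * t + b ^+ 2 = c.
Proof.
move=> nt4; have nz4 : 4 != 0 :> F by rewrite (_ : 4 = 2 * 2) ?mulf_neq0 //; ring.
have nzd : t ^+ 2 - 4 != 0 by rewrite subr_eq0.
have [x [y e]] := binary_form_repr c nzd.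
exists (x - t * y), (2 * y); rewrite -e; ring.
Qed.

End FiniteForms.

(** * Counting over a finite field *)

Section FieldCounting.
Local Open Scope ring_scope.
Variable F : finFieldType.
Hypothesis two_neq0 : 2 != 0 :> F.
Implicit Types (a b d s t x y : F).
Local Notation q := #|F|.

(* nsqrt (t ^+ 2 - 4) is the number of eigenvalues in F of a matrix of SL(2, F) of trace t. *)
Definition nsqrt d := #|[set s : F | s ^+ 2 == d]|.

Lemma four_neq0 : 4 != 0 :> F.
Proof. by rewrite (_ : 4 = 2 * 2) ?mulf_neq0 //; ring. Qed.

Lemma nsqrt0 : nsqrt 0 = 1%N.
Proof. by rewrite /nsqrt (_ : [set _ | _] = [set 0]) ?cards1 //; apply/setP=> s;
  rewrite !inE sqrf_eq0. Qed.

Lemma nsqrt_sqr s : s != 0 -> nsqrt (s ^+ 2) = 2.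
Proof.
move=> nz; rewrite /nsqrt (_ : [set _ | _] = [set s; - s]); last first.
  by apply/setP=> y; rewrite !inE eqf_sqr.
have ns : s != - s by rewrite -subr_eq0 opprK (_ : s + s = 2 * s) ?mulf_neq0 //; ring.
by rewrite cards2 ns.
Qed.

Variant nsqrt_spec d : nat -> bool -> Prop :=
  | NsqrtZero of d = 0 : nsqrt_spec d 1 true
  | NsqrtSquare of d != 0 : nsqrt_spec d 2 false
  | NsqrtNonsquare of d != 0 : nsqrt_spec d 0 false.

Lemma nsqrtP d : nsqrt_spec d (nsqrt d) (d == 0).
Proof.
have [->|nz] := eqVneq d 0; first by rewrite nsqrt0; constructor.
have [e|[s]] := set_0Vmem [set s : F | s ^+ 2 == d].
  by rewrite /nsqrt e cards0; constructor.
rewrite inE => /eqP ds; rewrite -ds nsqrt_sqr; first by constructor; rewrite ds.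
by rewrite -sqrf_eq0 ds.
Qed.

(* The pairs (a, b) such that a + b x has determinant 1, for x of determinant 1 and trace t. *)
Definition norm_one t := [set u : F * F | u.1 ^+ 2 + u.1 * u.2 * t + u.2 ^+ 2 == 1].

Lemma card_norm_one t : t ^+ 2 != 4 -> (#|norm_one t| + nsqrt (t ^+ 2 - 4)%R = q + 1)%N.
Proof.
(* With u = 2 a + t b the equation is u ^+ 2 - d b ^+ 2 = 4, a conic which is parametrized by the
   lines through the point u = - 2, b = 0. *)
move=> nt4; have nz4 := four_neq0; set d := t ^+ 2 - 4.
have nzd : d != 0 by rewrite subr_eq0.
set C := norm_one t; pose M := [set m : F | 1 - d * m ^+ 2 != 0].
pose f m : F * F := let e := (1 - d * m ^+ 2)^-1 in
  ((1 + d * m ^+ 2 - 2 * t * m) * e, 4 * m * e).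
have inj_f : {in M &, injective f}.
  move=> m n; rewrite !inE => nzm nzn [e1 e2].
  have k m' : 1 - d * m' ^+ 2 != 0 -> 2 * ((1 + d * m' ^+ 2 - 2 * t * m') * (1 - d * m' ^+ 2)^-1)
    + t * (4 * m' * (1 - d * m' ^+ 2)^-1) + 2 = 4 * (1 - d * m' ^+ 2)^-1.
    by move=> nz; field.
  have e : (1 - d * m ^+ 2)^-1 = (1 - d * n ^+ 2)^-1.
    by apply: (mulfI nz4); rewrite -!k // e1 e2.
  by move: e2; rewrite e -!mulrA => /(mulfI nz4) /mulIf; apply; rewrite invr_neq0.
have fM : f @: M = C :\ (-1, 0).
  apply/setP=> [[a b]]; apply/imsetP/idP => [[m] | ].
    rewrite !inE => nzm [-> ->] /=; apply/andP; split; last first.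
      rewrite -subr_eq0; apply/eqP; rewrite /d in nzm *; field; exact: nzm.
    apply/eqP=> -[e1 e2]; have m0 : m = 0.
      apply: (mulfI nz4); rewrite mulr0; apply/eqP; move/eqP: e2.
      by rewrite mulf_eq0 invr_eq0 (negPf nzm) orbF.
    move: e1; rewrite m0 expr0n /= !mulr0 !subr0 addr0 invr1 mulr1 => /eqP.
    by rewrite -subr_eq0 opprK; apply/negP.
  rewrite !inE /= xpair_eqE => /andP[nab /eqP ab].
  have ab' : (2 * a + t * b) ^+ 2 = d * b ^+ 2 + 4.
    have -> : (2 * a + t * b) ^+ 2 = 4 * (a ^+ 2 + a * b * t + b ^+ 2) + d * b ^+ 2 by rewrite /d;
      ring.
    by rewrite ab mulr1 addrC.
  have nz : 2 * a + t * b + 2 != 0.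
    apply: contra nab; rewrite addr_eq0 => /eqP e.
    have b0 : b = 0.
      have : d * b ^+ 2 == 0 by rewrite -[X in X == _](addrK 4) -ab' e sqrrN; apply/eqP; ring.
      by rewrite mulf_eq0 (negPf nzd) sqrf_eq0 => /eqP.
    rewrite b0 eqxx andbT; apply/eqP/(mulfI two_neq0).
    by move: e; rewrite b0 mulr0 addr0 mulrN1.
  set u := 2 * a + t * b in ab' nz.
  have db : 1 - d * (b / (u + 2)) ^+ 2 = 4 / (u + 2).
    have -> : d * (b / (u + 2)) ^+ 2 = (d * b ^+ 2) / (u + 2) ^+ 2 by field.
    have -> : d * b ^+ 2 = u ^+ 2 - 4 by rewrite ab' addrK.
    by field.
  have nz' : 1 - d * (b / (u + 2)) ^+ 2 != 0 by rewrite db mulf_neq0 ?invr_neq0.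
  exists (b / (u + 2)); first by rewrite inE.
  rewrite /f; have -> : 1 + d * (b / (u + 2)) ^+ 2 = 2 - (1 - d * (b / (u + 2)) ^+ 2) by ring.
  rewrite db; congr (_, _); last by field; rewrite nz nz4.
  apply: (mulfI two_neq0); have -> : 2 * a = u - t * b by rewrite /u addrK.
  by field; rewrite nz nz4.
have C1 : (-1, 0) \in C by rewrite inE /= mulr0 mul0r addr0 expr0n addr0 sqrrN expr1n.
rewrite (cardsD1 (-1, 0)) C1 -fM card_in_imset //.
(* The excluded slopes are the inverses of the square roots of [d]: they correspond to the points at
   infinity of the conic. *)
have -> : nsqrt d = #|~: M|.
  rewrite /nsqrt -(card_imset _ (@invr_inj F)); apply: eq_card => m; rewrite !inE negbK.
  apply/imsetP/idP => [[s] | ].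
    rewrite inE => /eqP ds ->; rewrite -ds exprVn divff ?subrr // ds //.
  rewrite subr_eq0 eq_sym => /eqP e; exists m^-1; rewrite ?invrK // inE exprVn.
  have nzm : m ^+ 2 != 0 by apply: contra_eq_neq e => ->; rewrite mulr0 eq_sym oner_neq0.
  by apply/eqP/(mulIf nzm); rewrite mulVf.
by rewrite -addnA addnC cardsC.
Qed.

(** The form is now the square of [a + b t / 2], so the solutions fill two parallel lines. *)
Lemma card_norm_one_degenerate t : t ^+ 2 = 4 ->
  #|norm_one t| = (2 * q)%N.
Proof.
move=> t4; pose f (u : F * F) := (u.1 + u.2 * t / 2, u.2).
have inj_f : injective f by move=> [a b] [c d] [+ e]; rewrite e => /addIr ->.
rewrite -(card_imset _ inj_f) (_ : _ @: _ = setX [set 1; -1] setT).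
  rewrite cardsX cardsT cards2 -subr_eq0 opprK -[1 + 1]/(2%:R) two_neq0 //.
apply/setP=> [[x y]]; rewrite in_setX in_setT andbT !inE.
have key : (x - y * t / 2) ^+ 2 + (x - y * t / 2) * y * t + y ^+ 2 = x ^+ 2.
  have -> : (x - y * t / 2) ^+ 2 + (x - y * t / 2) * y * t + y ^+ 2 = x ^+ 2 + y ^+ 2 * (1 - t ^+
    2 / 4) by field; rewrite two_neq0 four_neq0.
  by rewrite t4 divff ?four_neq0 // subrr mulr0 addr0.
rewrite -eqf_sqr expr1n -key; apply/imsetP/idP => [[[a b]] | e].
  by rewrite inE /= => /eqP e [-> ->]; rewrite addrK e.
by exists (x - y * t / 2, y); rewrite ?inE // /f /= subrK.
Qed.

Lemma card_hyperbola e : #|[set u : F * F | u.1 * u.2 == e]| = (q.-1 + (e == 0)%R * q)%N.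
Proof.
have q0 : (0 < q)%N by apply/card_gt0P; exists 0.
have cF : #|[set~ 0 : F]| = q.-1 by rewrite cardsC1.
have [-> | nz] := eqVneq e 0; last first.
  have inj : injective (fun y : F => (y, e / y)) by move=> y z [].
  rewrite mul0n addn0 -cF -(card_imset _ inj); apply: eq_card => -[y z]; rewrite !inE /=.
  apply/eqP/imsetP => [yz | [y' ]].
    have ny : y != 0 by apply: contra_eq_neq yz => ->; rewrite mul0r eq_sym.
    by exists y; rewrite ?inE // -yz mulrC mulKf.
  by rewrite !inE => ny [-> ->]; rewrite mulrC divfK.
rewrite mul1n -cF; pose A := setX [set~ 0 : F] [set 0 : F].
have -> : [set u : F * F | u.1 * u.2 == 0] = A :|: setX [set 0] setT.
  apply/setP=> [[y z]]; rewrite !inE /= mulf_eq0 andbT orbC.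
  by case: (y == 0); rewrite ?orbT ?andbT ?orbF.
rewrite cardsU (_ : A :&: _ = set0) ?cards0 ?subn0; last first.
  by apply/setP=> [[y z]]; rewrite !inE; case: (y == 0); rewrite ?andbF.
by rewrite !cardsX !cards1 cardsT muln1 mul1n.
Qed.

(** The sum counts the points of [s ^+ 2 = t ^+ 2 - 4], which is the hyperbola
    [(t - s) * (t + s) = 4]. *)
Lemma sum_nsqrt : (\sum_(t : F) nsqrt (t ^+ 2 - 4)%R = q.-1)%N.
Proof.
have := card_hyperbola 4; rewrite (negPf four_neq0) mul0n addn0 => <-.
pose f (u : F * F) := (u.1 - u.2, u.1 + u.2).
have inj_f : injective f.
  move=> [a b] [c d] [e1 e2]; have ac : a = c.
    apply: (mulfI two_neq0); have -> : 2 * a = (a - b) + (a + b) by ring.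
    by rewrite e1 e2; ring.
  by move: e2; rewrite ac => /addrI ->.
have -> : [set u : F * F | u.1 * u.2 == 4] = f @: [set u : F * F | u.2 ^+ 2 == u.1 ^+ 2 - 4].
  apply/setP=> [[y z]]; rewrite inE /=; apply/eqP/imsetP => [yz | [[a b]]].
    exists ((y + z) / 2, (z - y) / 2); last by rewrite /f /=; congr (_, _); field.
    by rewrite inE /= -yz; apply/eqP; field; rewrite two_neq0 ?four_neq0.
  by rewrite inE /= => /eqP e [-> ->]; rewrite -[4](subKr (a ^+ 2)) -e; ring.
rewrite card_imset // -sum1dep_card -(pair_big_dep predT (fun t s => s ^+ 2 == t ^+ 2 - 4) (fun _
  _ => 1%N)) /=.
by apply: eq_bigr => t _; rewrite sum1dep_card.
Qed.

Lemma card_unipotent_traces : #|[set t : F | nsqrt (t ^+ 2 - 4) == 1%N]| = 2.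
Proof.
rewrite -(nsqrt_sqr two_neq0) /nsqrt; apply: eq_card => t; rewrite !inE.
have -> : (2 ^+ 2 = 4 :> F) by ring.
by rewrite -/(nsqrt _) -[RHS]subr_eq0; case: nsqrtP.
Qed.

(** Two linear equations determine the numbers: the traces with 0, 1 and 2 eigenvalues partition F,
    the middle class having 2 elements, and [sum_nsqrt] gives the weighted sum. *)
Lemma card_split_traces :
  (2 * #|[set t : F | nsqrt (t ^+ 2 - 4)%R == 2]| + 3 = q)%N /\
  (2 * #|[set t : F | nsqrt (t ^+ 2 - 4)%R == 0]| + 1 = q)%N.
Proof.
set T2 := [set t | _ == 2]; set T0 := [set t | _ == 0%N].
pose T1 := [set t : F | nsqrt (t ^+ 2 - 4) == 1%N].
have cT1 : #|T1| = 2 := card_unipotent_traces.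
have q0 : (0 < q)%N by apply/card_gt0P; exists 0.
have s2 : (\sum_(t : F) nsqrt (t ^+ 2 - 4)%R = 2 * #|T2| + #|T1|)%N.
  rewrite -!sum1_card big_distrr /= (bigID (mem T2)) /= muln1; congr (_ + _)%N.
    by apply: eq_bigr => t; rewrite inE => /eqP.
  rewrite (bigID (mem T1)) /= [X in (_ + X)%N]big1 ?addn0.
    by apply: eq_big => t; rewrite !inE; [case: nsqrtP | case: nsqrtP].
  by move=> t; rewrite !inE; case: nsqrtP.
have s1 : (q = #|T2| + #|T1| + #|T0|)%N.
  have cA (A : {set F}) : #|A| = (\sum_(t : F) (t \in A))%N.
    by rewrite -sum1_card big_mkcond; apply: eq_bigr => t _; case: (t \in A).
  rewrite !cA -!big_split -sum1_card; apply: eq_bigr => t _.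
  by rewrite !inE; case: nsqrtP.
move: s2; rewrite sum_nsqrt cT1 => s2; rewrite cT1 in s1; lia.
Qed.

End FieldCounting.

(** * The special linear group *)

Section SL2Theory.
Local Open Scope group_scope.
(** SL(2, F) is given by [mx], an injective multiplicative map sending [S] onto the matrices of
    determinant 1; calculations are done on matrices while the group notions stay in [gT]. *)
Variables (F : finFieldType) (gT : finGroupType) (S : {group gT}) (mx : gT -> 'M[F]_2).
Hypothesis mxM : forall g h, mx (g * h) = (mx g *m mx h)%R.
Hypothesis mx_inj : injective mx.
Hypothesis SLP : forall g, reflect (\det (mx g) = 1)%R (g \in S).
Hypothesis exists_SL2 : forall A : 'M[F]_2, (\det A = 1)%R -> exists2 g, g \in S & mx g = A.
Hypothesis two_neq0 : (2 != 0 :> F)%R.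
Hypothesis three_neq0 : (3 != 0 :> F)%R.
Local Notation Z := 'Z(S).
Local Notation tr g := (\tr (mx g))%R.
Implicit Types (g h x y a b u : gT) (v w : 'rV[F]_2).

Lemma mx1 : mx 1 = 1%:M%R.
Proof.
have d1 := elimT (SLP 1) (group1 S).
have u1 : mx 1 \in unitmx by rewrite unitmxE d1 unitr1.
by apply: (can_inj (mulKmx u1)); rewrite -mxM mulg1 mulmx1.
Qed.

Lemma mx_commute g h : commute g h -> (mx g *m mx h = mx h *m mx g)%R.
Proof. by move=> e; rewrite -!mxM e. Qed.

Lemma commute_mx g h : (mx g *m mx h = mx h *m mx g)%R -> commute g h.
Proof. by move=> e; apply: mx_inj; rewrite !mxM. Qed.

Lemma mxK g h : (mx g *m mx h = 1%:M)%R -> h = g^-1.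
Proof. by move=> e; apply/esym/eqP; rewrite eq_invg_mul -(inj_eq mx_inj) mxM e mx1. Qed.

Lemma mxV g : g \in S -> mx g^-1 = ((tr g)%:M - mx g)%R.
Proof.
move/SLP=> dg; have [h Sh hE] : exists2 h, h \in S & mx h = ((tr g)%:M - mx g)%R.
  apply: exists_SL2; have -> : (\det ((tr g)%:M - mx g) = \det (mx g))%R; last by [].
  by rewrite !lin2E; ring.
rewrite -(@mxK g h) //.
by rewrite hE mulmxBr mul_mx_scalar Cayley_Hamilton2 dg opprB addrCA subrr addr0.
Qed.

Lemma trJ g h : tr (g ^ h) = tr g.
Proof. by rewrite conjgE !mxM mxtrace_mulC -mulmxA -mxM mulgV mx1 mulmx1. Qed.

Lemma exists_negone : exists2 z : gT, z \in S & mx z = (-1)%:M%R.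
Proof. by apply: exists_SL2; rewrite det_scalar sqrrN expr1n. Qed.

(** The default 1 never occurs, by [exists_negone]. *)
Definition negone : gT := odflt 1 [pick z : gT | (z \in S) && (mx z == (-1)%:M%R)].

Lemma negoneP : negone \in S /\ mx negone = (-1)%:M%R.
Proof.
rewrite /negone; case: pickP => [z /andP[Sz /eqP] // | nz].
by have [z Sz zE] := exists_negone; have := nz z; rewrite Sz zE eqxx.
Qed.

Lemma mx_negone : mx negone = (-1)%:M%R. Proof. by case: negoneP. Qed.
Lemma negone_SL2 : negone \in S. Proof. by case: negoneP. Qed.

Lemma SL2_scalar g : g \in S -> is_scalar_mx (mx g) -> g = 1 \/ g = negone.
Proof.
move/SLP=> dg /is_scalar_mxP[l gl]; move: dg; rewrite gl det_scalar => /eqP.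
rewrite -[1%R](expr1n _ 2) eqf_sqr => /orP[]/eqP l1; [left | right]; apply: mx_inj.
  by rewrite /= gl l1 mx1.
by rewrite /= gl l1 mx_negone.
Qed.

Lemma center_SL2 : Z = [set 1; negone].
Proof.
apply/setP=> g; rewrite [RHS]inE !in_set1; apply/idP/orP=> [/centerP[Sg cg] | [/eqP->|/eqP->]].
(* Commuting with the two elementary transvections already forces a matrix to be scalar. *)
- have [u Su uE] : exists2 u, u \in S & mx u = mx2 1 1 0 1.
    by apply: exists_SL2; rewrite !lin2E; ring.
  have [w Sw wE] : exists2 u, u \in S & mx u = mx2 1 0 1 1.
    by apply: exists_SL2; rewrite !lin2E; ring.
  have := mx_commute (cg u Su); have := mx_commute (cg w Sw).
  rewrite uE wE => /matrixP cw /matrixP cu.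
  have [|->|->] := @SL2_scalar g Sg; [|by left|by right].
  apply/is_scalar_mxP; exists (mx g 0 0)%R; move: (mx g) cw cu => A cw cu.
  have := cu 0%R 0%R; have := cu 0%R 1%R; have := cw 0%R 0%R.
  rewrite !lin2E !mulr1 !mulr0 !mul0r !mul1r !addr0 ?add0r => e0 e1 e2.
  have A10 : A 1%R 0%R = 0%R by apply: (addrI (A 0%R 0%R)); rewrite addr0 -e2.
  have A01 : A 0%R 1%R = 0%R by apply: (addrI (A 0%R 0%R)); rewrite addr0.
  apply: mx2P; rewrite !lin2E // .
  by move: e1; rewrite A01 addr0 add0r.
- exact: group1.
apply/centerP; split=> [|y _]; first exact: negone_SL2.
by apply: commute_mx; rewrite mx_negone scalar_mxC.
Qed.

Lemma SL2_nonscalar g : g \in S :\: Z -> ~~ is_scalar_mx (mx g).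
Proof.
case/setDP=> Sg; apply: contra => /(SL2_scalar Sg); rewrite center_SL2 !inE.
by case=> ->; rewrite eqxx ?orbT.
Qed.

Lemma SL2_scalarP g : g \in S -> reflect (exists l, mx g = l%:M%R) (g \in Z).
Proof.
move=> Sg; apply: (iffP idP) => [Zg | [l gl]].
  by apply/is_scalar_mxP/negPn/negP => ns; move: Zg; rewrite center_SL2 !inE => /orP[]/eqP e;
    case/negP: ns; apply/is_scalar_mxP; [exists 1%R | exists (-1)%R]; rewrite e ?mx_negone ?mx1.
apply: contraT => nZ; have := SL2_nonscalar (introT setDP (conj Sg nZ)).
by rewrite gl scalar_mx_is_scalar.
Qed.

Lemma cent1_SL2P a b : a \in S :\: Z -> b \in S ->
  reflect (exists k l, mx b = (k%:M + l *: mx a)%R) (b \in 'C_S[a]).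
Proof.
move=> nca Sb; rewrite in_setI Sb /=; apply: (iffP cent1P) => [/mx_commute c | [k [l e]]].
  by apply: comm_linear2; rewrite ?SL2_nonscalar.
by apply: commute_mx; rewrite e mulmxDr mulmxDl scalar_mxC -scalemxAl -scalemxAr.
Qed.

Lemma SL2_cent1_abelian : {in S :\: Z, forall a, abelian 'C_S[a]}.
Proof.
move=> a nca; apply/centsP => b Cb c Cc.
have [Sb _] := setIP Cb; have [Sc _] := setIP Cc.
have [k [l eb]] := elimT (cent1_SL2P nca Sb) Cb.
have [k' [l' ec]] := elimT (cent1_SL2P nca Sc) Cc.
by apply: commute_mx; rewrite eb ec !mul_linear2; congr (_%:M + _ *: _)%R; ring.
Qed.

Lemma linear_center x g k l : x \in S :\: Z -> g \in S -> mx g = (k%:M + l *: mx x)%R ->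
  (g \in Z) = (l == 0)%R.
Proof.
move=> ncx Sg gE; apply/(SL2_scalarP Sg)/eqP => [[m] | l0]; last first.
  by exists k; rewrite gE l0 scale0r addr0.
rewrite gE -[RHS]addr0 -(scale0r (mx x)) => e.
by have [] := linear2_inj (SL2_nonscalar ncx) e.
Qed.

Lemma expg2_SL2 x : x \in S -> mx (x ^+ 2) = ((- 1)%:M + tr x *: mx x)%R.
Proof. by move/SLP=> dx; rewrite expgS expg1 mxM Cayley_Hamilton2 dx addrC raddfN. Qed.

Lemma expg3_SL2 x : x \in S ->
  mx (x ^+ 3) = ((- tr x)%:M + ((tr x) ^+ 2 - 1) *: mx x)%R.
Proof.
move=> Sx; rewrite expgSr mxM expg2_SL2 //.
have {3}-> : mx x = (0%:M + 1 *: mx x)%R by rewrite scale1r raddf0 add0r.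
rewrite mul_linear2 (SLP _ Sx).
by congr (_%:M + _ *: _)%R; ring.
Qed.

Lemma expg4_SL2 x : x \in S ->
  mx (x ^+ 4) = ((1 - (tr x) ^+ 2)%:M + (tr x * ((tr x) ^+ 2 - 2)) *: mx x)%R.
Proof.
move=> Sx; rewrite (expgM _ 2 2) expgS expg1 mxM expg2_SL2 // mul_linear2 (SLP _ Sx).
by congr (_%:M + _ *: _)%R; ring.
Qed.

Lemma expg2_center x : x \in S :\: Z -> (x ^+ 2 \in Z) = (tr x == 0)%R.
Proof. by move=> ncx; have [Sx _] := setDP ncx; apply: (linear_center ncx (groupX 2 Sx) (expg2_SL2
  Sx)). Qed.

Lemma expg3_center x : x \in S :\: Z -> (x ^+ 3 \in Z) = (tr x ^+ 2 == 1)%R.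
Proof.
move=> ncx; have [Sx _] := setDP ncx.
by rewrite (linear_center ncx (groupX 3 Sx) (expg3_SL2 Sx)) subr_eq0.
Qed.

Lemma expg4_center x : x \in S :\: Z ->
  (x ^+ 4 \in Z) = ((tr x == 0) || (tr x ^+ 2 == 2%:R))%R.
Proof.
move=> ncx; have [Sx _] := setDP ncx.
by rewrite (linear_center ncx (groupX 4 Sx) (expg4_SL2 Sx)) mulf_eq0 subr_eq0.
Qed.

Let cZ := center_SL2.
Let cA := SL2_cent1_abelian.

Lemma char2_neq : (1 != -1 :> F)%R.
Proof. by rewrite -subr_eq0 opprK -[(1 + 1)%R]/(2%:R)%R. Qed.

Lemma negone_neq1 : negone != 1.
Proof.
apply/eqP=> e; have := congr1 (fun g => mx g 0 0)%R e.
by rewrite /= mx_negone mx1 !scalar2E => /eqP; rewrite eq_sym (negPf char2_neq).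
Qed.

(** * Stabilizers of lines *)

Definition line_stab v := [set g in S | ((v *m mx g)%R <= v)%MS].

Lemma line_stabP v g : reflect (g \in S /\ exists l, (v *m mx g = l *: v)%R) (g \in line_stab v).
Proof.
rewrite inE; apply: (iffP andP) => [[Sg /sub_rVP] | [Sg e]]; first by split.
by split=> //; apply/sub_rVP.
Qed.

Lemma line_stab_group_set v : group_set (line_stab v).
Proof.
apply/group_setP; split=> [|g h]; first by rewrite inE group1 mx1 mulmx1 submx_refl.
rewrite !inE => /andP[Sg vg] /andP[Sh vh]; rewrite groupM //= mxM mulmxA.
exact: submx_trans (submxMr _ vg) vh.
Qed.
Canonical line_stab_group v := Group (line_stab_group_set v).

Lemma line_stab_sub v : line_stab v \subset S.
Proof. by apply/subsetP=> g; rewrite inE => /andP[]. Qed.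

Lemma fix_vector_commute v g h : v != 0%R -> g \in S -> h \in S ->
  (v *m mx g = v)%R -> (v *m mx h = v)%R -> commute g h.
Proof.
move=> nzv Sg Sh vg vh; have [k gE] := fix_vector_transvector nzv (SLP _ Sg) vg.
have [l hE] := fix_vector_transvector nzv (SLP _ Sh) vh.
by apply: commute_mx; rewrite gE hE !mul_linear2; congr (_%:M + _ *: _)%R; ring.
Qed.

Lemma eigenvalue_V v g l : g \in S -> v != 0%R -> (v *m mx g = l *: v)%R ->
  l != 0%R /\ (v *m mx g^-1 = l^-1 *: v)%R.
Proof.
move=> Sg nzv vg; have gK : (mx g *m mx g^-1 = 1%:M)%R by rewrite -mxM mulgV mx1.
have l0 : l != 0%R.
  apply: contraNneq nzv => l0; rewrite -(mulmx1 v) -gK mulmxA vg l0 scale0r mul0mx //.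
split=> //; rewrite -[in LHS](scalerK l0 v) -scalemxAl -vg -mulmxA gK mulmx1.
by [].
Qed.

Lemma line_stab_commg v g h : v != 0%R -> g \in line_stab v -> h \in line_stab v ->
  (v *m mx [~ g, h] = v)%R.
Proof.
move=> nzv /line_stabP[Sg [k vg]] /line_stabP[Sh [l vh]].
have [k0 vgV] := eigenvalue_V Sg nzv vg; have [l0 vhV] := eigenvalue_V Sh nzv vh.
rewrite commgEl conjgE !mxM !mulmxA vgV -!scalemxAl vhV -!scalemxAl vg -!scalemxAl vh !scalerA.
by rewrite [X in (X *: _)%R](_ : _ = 1%R) ?scale1r //; field; rewrite k0 l0.
Qed.

(** Commutators fix the vector [v] itself, and the elements fixing it form an abelian group. For
    [v = 0] the stabilizer would be all of [S]. *)
Lemma line_stab_solvable v : v != 0%R -> solvable (line_stab v).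
Proof.
move=> nzv; have gS : group_set [set g in S | (v *m mx g == v)%R].
  apply/group_setP; split=> [|g h]; first by rewrite inE group1 mx1 mulmx1 eqxx.
  rewrite !inE => /andP[Sg /eqP vg] /andP[Sh /eqP vh]; rewrite groupM //= mxM mulmxA.
  by rewrite vg vh.
apply: (@solvable_commg _ _ (Group gS)).
  apply/centsP => g; rewrite inE => /andP[Sg /eqP vg] h; rewrite inE => /andP[Sh /eqP vh].
  exact: fix_vector_commute nzv Sg Sh vg vh.
move=> g h vg vh; rewrite inE line_stab_commg ?eqxx ?andbT // groupR //.
  exact: subsetP (line_stab_sub v) g vg.
exact: subsetP (line_stab_sub v) h vh.
Qed.

Lemma noncentral_SL2 x : x \in S :\: Z -> x \in S. Proof. by case/setDP. Qed.

Lemma two_line_stabs_commute v w g h : v != 0%R -> ~~ (w <= v)%MS ->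
  g \in line_stab v -> g \in line_stab w -> h \in line_stab v -> h \in line_stab w -> commute g h.
Proof.
move=> nzv nwv /line_stabP[_ [a vg]] /line_stabP[_ [b wg]] /line_stabP[_ [c vh]] /line_stabP[_ [d
  wh]].
apply: commute_mx; apply: (mulmx_independent nzv nwv); rewrite !mulmxA ?vg ?wg ?vh ?wh.
  by rewrite -!scalemxAl vg vh !scalerA mulrC.
by rewrite -!scalemxAl wg wh !scalerA mulrC.
Qed.

(** The other eigenvalue is [tr x - l]. Its eigenvector spans a second line unless the two
    eigenvalues coincide, and then both are 1 or both are - 1. *)
Lemma line_stab_split v x : v != 0%R -> x \in S :\: Z -> x \in line_stab v ->
  (tr x ^+ 2 = 4)%R \/ exists w, ~~ (w <= v)%MS /\ x \in line_stab w.
Proof.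
move=> nzv ncx /line_stabP[Sx [l vx]]; have dx := elimT (SLP x) Sx.
have := eigenvalue2 nzv vx; rewrite dx => el.
have el' : ((tr x - l) ^+ 2 - tr x * (tr x - l) + \det (mx x) = 0)%R by rewrite dx -[RHS]el; ring.
have [w nzw wx] := exists_eigenvector2 (SL2_nonscalar ncx) el'.
have [/sub_rVP[c wE] | nwv] := boolP (w <= v)%MS; last first.
  by right; exists w; split=> //; apply/line_stabP; split=> //; exists (tr x - l)%R.
left; have e : (tr x - l = l)%R.
  have : ((tr x - l - l) *: w = 0)%R.
    by rewrite scalerBl -wx {1}wE -scalemxAl vx scalerA mulrC -scalerA -wE subrr.
  by move/eqP; rewrite scaler_eq0 (negPf nzw) orbF subr_eq0 => /eqP.
have t2 : (tr x = 2 * l)%R by rewrite -{1}[tr x](subrK l) e; ring.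
rewrite t2; have : (l ^+ 2 = 1)%R by apply/eqP; rewrite -subr_eq0 -oppr_eq0 -[X in _ == X]el t2;
  apply/eqP; ring.
by move=> l2; rewrite exprMn l2; ring.
Qed.

Lemma line_stab_cent1 v x y : x \in S :\: Z -> x \in line_stab v -> y \in 'C_S[x] ->
  y \in line_stab v.
Proof.
move=> ncx /line_stabP[Sx [l vx]] Cy; have [Sy _] := setIP Cy.
have [a [b yE]] := elimT (cent1_SL2P ncx Sy) Cy.
apply/line_stabP; split=> //; exists (a + b * l)%R.
by rewrite yE mulmxDr mul_mx_scalar -scalemxAr vx scalerA scalerDl.
Qed.

(** A commutator of elements fixing the line fixes [v], whereas [negone] does not: anticommuting
    elements have no common fixed line. *)
Lemma line_stab_negone v g h : v != 0%R -> g \in line_stab v -> h \in line_stab v ->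
  [~ g, h] <> negone.
Proof.
move=> nzv vg vh e; have := line_stab_commg nzv vg vh.
rewrite e mx_negone mul_mx_scalar scaleN1r => /eqP.
rewrite eq_sym -subr_eq0 opprK -mulr2n -scaler_nat scaler_eq0 (negPf nzv) orbF.
by rewrite (negPf two_neq0).
Qed.

(** * Normalizers of centralizers *)

Lemma norm_unipotent_sub u : u \in S :\: Z -> (tr u ^+ 2 = 4)%R ->
  exists2 v, v != 0%R & u \in line_stab v /\ 'N_S('C_S[u]) \subset line_stab v.
Proof.
move=> ncu t4; have Su := noncentral_SL2 ncu; have du := elimT (SLP u) Su.
pose l := (tr u / 2)%R.
have l2 : (l ^+ 2 = 1)%R by rewrite /l expr_div_n t4 (_ : 4 = 2 ^+ 2)%R ?divff ?expf_neq0 //; ring.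
have t2 : (tr u = 2 * l)%R by rewrite /l mulrC divfK.
have el : (l ^+ 2 - tr u * l + \det (mx u) = 0)%R.
  rewrite du t2 (_ : l ^+ 2 - 2 * l * l + 1 = 1 - l ^+ 2)%R; last by ring.
  by rewrite l2 subrr.
have [v nzv vu] := exists_eigenvector2 (SL2_nonscalar ncu) el.
have uniq_l w k : w != 0%R -> (w *m mx u = k *: w)%R -> k = l.
  move=> nzw /(eigenvalue2 nzw); rewrite du t2 => e.
  apply/eqP; rewrite -subr_eq0 -sqrf_eq0.
  have -> : ((k - l) ^+ 2 = (k ^+ 2 - 2 * l * k + 1) + (l ^+ 2 - 1))%R by ring.
  by rewrite e l2 subrr addr0.
exists v => //; split; first by apply/line_stabP; split=> //; exists l.
apply/subsetP=> x /setIP[Sx Nx].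
(* [u ^ x^-1] lies in F[u], so [v] is an eigenvector of it and [v *m mx x] is one of [u]. As [l] is
   the only eigenvalue of [u], a second line would make [u] scalar. *)
have Cux : u ^ x^-1 \in 'C_S[u] by rewrite memJ_norm ?groupV // in_setI Su; apply/cent1P.
have Suxi : u ^ x^-1 \in S by rewrite groupJ ?groupV.
have [a [b uE]] := elimT (cent1_SL2P ncu Suxi) Cux.
have xu : (mx x *m mx u = mx (u ^ x^-1) *m mx x)%R by rewrite -!mxM conjgE invgK !mulgA mulgKV.
have vxu : (v *m mx x *m mx u = (a + b * l) *: (v *m mx x))%R.
  rewrite -mulmxA xu mulmxA uE mulmxDr mul_mx_scalar -scalemxAr vu scalerA -scalerDl.
  by rewrite -scalemxAl.
have nzvx : (v *m mx x != 0)%R.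
  apply: contraNneq nzv => e; rewrite -(mulmx1 v) -mx1 -(mulgV x) mxM mulmxA e mul0mx //.
have kl := uniq_l _ _ nzvx vxu; rewrite kl in vxu.
have [s | ns] := boolP ((v *m mx x)%R <= v)%MS; first by rewrite inE Sx.
case/negP: (SL2_nonscalar ncu); apply/is_scalar_mxP; exists l.
by apply: (mulmx_independent nzv ns); rewrite ?vu ?vxu mul_mx_scalar.
Qed.

Lemma conj_cent1 x y : y \in S -> 'C_S[x] :^ y = 'C_S[x ^ y].
Proof. by move=> Sy; rewrite conjIg cent1J conjGid. Qed.

Lemma cent1V x : 'C_S[x^-1] = 'C_S[x].
Proof. by rewrite -!cent_cycle cycleV. Qed.

Lemma norm_cent1_inv x y : y \in S -> x ^ y = x^-1 -> y \in 'N('C_S[x]).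
Proof. by move=> Sy e; rewrite inE conj_cent1 // e cent1V. Qed.

(** [x ^ y] lies in F[x] and has the trace of [x], so it is [x] or its inverse. In the second case
    [y ^+ 2] commutes with both [x] and [y], which do not commute, so transitivity makes it
    central. *)
Lemma norm_torus x y : x \in S :\: Z -> (tr x ^+ 2 != 4)%R -> y \in S -> y \in 'N('C_S[x]) ->
  y \in 'C_S[x] \/ [/\ x ^ y = x^-1, y ^+ 2 \in Z & y \notin Z].
Proof.
move=> ncx nt4 Sy Ny; have Sx := noncentral_SL2 ncx; have dx := elimT (SLP x) Sx.
have Sxy : x ^ y \in S by rewrite groupJ.
have Cxy : x ^ y \in 'C_S[x] by rewrite memJ_norm // in_setI Sx; apply/cent1P.
have [a [b xyE]] := elimT (cent1_SL2P ncx Sxy) Cxy.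
have := trJ x y; have := elimT (SLP _) Sxy; rewrite xyE => db tb.
have [e|e] := linear2_same_trace two_neq0 dx nt4 db tb; rewrite -xyE in e.
  by left; rewrite in_setI Sy; apply/cent1P/commute_sym/commgP/conjg_fixP/mx_inj.
have xy : x ^ y = x^-1 by apply: mx_inj; rewrite e mxV.
have nxV : x^-1 != x.
  apply: contraNneq nt4 => e'; have : x ^+ 2 \in Z.
    by rewrite expgS expg1 -{1}e' mulVg group1.
  rewrite expg2_center // => /eqP t0.
  have := congr1 mx e'; rewrite mxV // t0 raddf0 sub0r => /eqP.
  rewrite -subr_eq0 -opprD oppr_eq0 -mulr2n -scaler_nat scaler_eq0 (negPf two_neq0) /= => /eqP x0.
  by move: dx; rewrite x0 det0 => /eqP; rewrite eq_sym oner_eq0.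
right; have nCy : y \notin 'C[x].
  apply: contraNN nxV => cyx; rewrite -xy; apply/eqP/conjg_fixP/commgP/commute_sym; exact/cent1P.
have nyZ : y \notin Z by apply: contra nCy => /centerP[_ /(_ x Sx)] cyx; apply/cent1P.
split=> //; apply: contraNT nCy => ny2; apply/cent1P.
have ncy2 : y ^+ 2 \in S :\: Z by rewrite inE ny2 groupX.
apply: (commute_trans cA ncy2) => //.
  by apply: commute_sym; apply: commuteX.
apply/commute_sym/commgP/conjg_fixP.
by rewrite expgS expg1 conjgM xy conjVg xy invgK.
Qed.

(** A unipotent centralizer has its normalizer inside a line stabilizer. Otherwise the normalizer
    fixes or inverts [x], so its commutators centralize [x]. *)
Lemma norm_cent1_solvable x : x \in S :\: Z -> solvable 'N_S('C_S[x]).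
Proof.
move=> ncx; have [t4 | nt4] := eqVneq (tr x ^+ 2)%R 4%R.
  have [v nzv [_ sub]] := norm_unipotent_sub ncx t4.
  exact: solvableS sub (line_stab_solvable nzv).
apply: (@solvable_commg _ _ 'C_S[x]); first exact: cA.
have Sx := noncentral_SL2 ncx.
have fixorinv y : y \in 'N_S('C_S[x]) -> x ^ y = x \/ x ^ y = x^-1.
  case/setIP=> Sy Ny; have [/setIP[_ /cent1P/commute_sym/commgP/conjg_fixP] |[]] := norm_torus ncx
    nt4 Sy Ny.
    by left.
  by right.
move=> g h Ng Nh; have [Sg _] := setIP Ng; have [Sh _] := setIP Nh.
rewrite in_setI groupR //=; apply/cent1P/commute_sym/commgP/conjg_fixP.
have -> : [~ g, h] = (h * g)^-1 * (g * h) by rewrite invMg commgEl conjgE !mulgA.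
have e : x ^ (g * h) = x ^ (h * g).
  by rewrite !conjgM; case: (fixorinv g Ng) => eg; case: (fixorinv h Nh) => eh;
    rewrite eg ?conjVg eh ?conjVg ?eg.
have Nn : (h * g)^-1 \in 'N_S('C_S[x]) by rewrite groupV groupM.
have := conjgKV (h * g) x; rewrite (conjgM x _ (g * h)).
by case: (fixorinv _ Nn) => ->; rewrite ?conjVg e.
Qed.

Lemma line_stab_subset v w : v != 0%R -> w != 0%R -> (w <= v)%MS -> line_stab w \subset line_stab v.
Proof.
move=> nzv nzw /sub_rVP[c wE]; have c0 : c != 0%R by apply: contraNneq nzw => c0;
  rewrite wE c0 scale0r.
apply/subsetP=> x /line_stabP[Sx [l wx]]; apply/line_stabP; split=> //; exists l.
by apply: (scalerI c0); rewrite scalemxAl -wE wx wE !scalerA mulrC.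
Qed.

Lemma unipotent_eigenvalue v u : v != 0%R -> (tr u ^+ 2 = 4)%R -> u \in line_stab v ->
  (v *m mx u = (tr u / 2) *: v)%R /\ ((tr u / 2) ^+ 2 = 1)%R.
Proof.
move=> nzv t4 /line_stabP[Su [l vu]]; have := eigenvalue2 nzv vu; rewrite (elimT (SLP u) Su) => el.
have l2 : ((tr u / 2) ^+ 2 = 1)%R.
  by rewrite expr_div_n t4 (_ : 4 = 2 ^+ 2)%R ?divff ?expf_neq0 //; ring.
split=> //; rewrite vu; congr (_ *: _)%R; apply/eqP; rewrite -subr_eq0 -sqrf_eq0.
have t2 : (tr u = 2 * (tr u / 2))%R by rewrite mulrC divfK.
have -> : ((l - tr u / 2) ^+ 2 = (l ^+ 2 - (2 * (tr u / 2)) * l + 1) + ((tr u / 2) ^+ 2 - 1))%R by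
  ring.
by rewrite -t2 el l2 subrr addr0.
Qed.

Lemma unipotent_line v w u : v != 0%R -> w != 0%R -> u \in S :\: Z -> (tr u ^+ 2 = 4)%R ->
  u \in line_stab v -> u \in line_stab w -> (w <= v)%MS.
Proof.
move=> nzv nzw ncu t4 /(unipotent_eigenvalue nzv t4)[vu _] /(unipotent_eigenvalue nzw t4)[wu _].
apply: contraT => ns; case/negP: (SL2_nonscalar ncu); apply/is_scalar_mxP; exists (tr u / 2)%R.
by apply: (mulmx_independent nzv ns); rewrite ?vu ?wu mul_mx_scalar.
Qed.

Lemma mx_negoneM g : mx (negone * g) = (- mx g)%R.
Proof. by rewrite mxM mx_negone mul_scalar_mx scaleN1r. Qed.

Lemma trN g : tr (negone * g) = (- tr g)%R.
Proof. by rewrite mx_negoneM linearN. Qed.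

Lemma negoneM_notinZ g : g \in S :\: Z -> negone * g \in S :\: Z.
Proof.
have Zn : negone \in Z by rewrite cZ !inE eqxx orbT.
case/setDP=> Sg nZ; apply/setDP; split; first by rewrite groupM ?negone_SL2.
by rewrite (groupMl _ Zn).
Qed.

Lemma unipotent_fix v u : v != 0%R -> (tr u ^+ 2 = 4)%R -> u \in line_stab v ->
  (v *m mx u = v)%R \/ (v *m mx (negone * u) = v)%R.
Proof.
move=> nzv t4 vu; have [e /eqP] := unipotent_eigenvalue nzv t4 vu.
rewrite -[X in _ == X](expr1n _ 2) eqf_sqr => /orP[]/eqP l1; rewrite l1 in e; [left | right].
  by rewrite e scale1r.
by rewrite mx_negoneM mulmxN e scaleN1r opprK.
Qed.

(** Up to the factor [negone] both elements fix [v] itself, and such elements commute. *)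
Lemma unipotent_commute v x y : v != 0%R -> (tr x ^+ 2 = 4)%R -> (tr y ^+ 2 = 4)%R ->
  x \in line_stab v -> y \in line_stab v -> commute x y.
Proof.
move=> nzv tx ty vx vy; have [Sx _] := elimT (line_stabP v x) vx;
  have [Sy _] := elimT (line_stabP v y) vy.
have Sn := negone_SL2.
have canc a b : b \in S -> commute (negone * a) b -> commute a b.
  by move=> Sb; rewrite /commute -mulgA => e; apply: (mulgI negone); rewrite e !mulgA (cz cZ Sb).
have fixc a b : a \in S -> b \in S -> (v *m mx a = v)%R -> (v *m mx b = v)%R -> commute a b.
  exact: fix_vector_commute.
have Snx := groupM Sn Sx; have Sny := groupM Sn Sy.
have [ex | ex] := unipotent_fix nzv tx vx; have [ey | ey] := unipotent_fix nzv ty vy.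
- exact: fixc.
- by apply: commute_sym; apply: (canc y x Sx); apply: fixc.
- by apply: (canc x y Sy); apply: fixc.
by apply: (canc x y Sy); apply: commute_sym; apply: (canc y _ Snx); apply: fixc.
Qed.

(** * Solvabilizers of generic elements *)

Local Notation Sol := (solvabilizer S).

Lemma solvabilizer_sym x y : x \in S -> y \in S -> (x \in Sol y) = (y \in Sol x).
Proof. by move=> Sx Sy; rewrite !inE Sx Sy setUC. Qed.

Lemma mem_solvabilizer x y (H : {group gT}) : y \in S -> solvable H -> x \in H -> y \in H ->
  y \in Sol x.
Proof.
move=> Sy solH Hx Hy; rewrite inE Sy; apply: solvableS solH.
by rewrite gen_subG subUset !sub1set Hx.
Qed.

Lemma solvabilizerV x : Sol x^-1 = Sol x.
Proof.
apply/setP=> y; rewrite !inE; congr (_ && solvable _); apply/eqP;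
  rewrite eqEsubset !gen_subG !subUset !sub1set.
have mg (a b : gT) : (a \in <<[set a; b]>>) * (b \in <<[set a;
  b]>>) by rewrite !mem_gen ?set21 ?set22.
by rewrite groupV !mg -[X in X \in _]invgK groupV mg.
Qed.

Lemma solvabilizer_negone x : x \in S -> Sol (negone * x) = Sol x.
Proof.
move=> Sx; have Sn := negone_SL2; have Zn : negone \in Z by rewrite cZ !inE eqxx orbT.
have nZ g : g \in S -> g \in 'N(Z) by apply: subsetP (gFnorm _ _) g.
have e : coset Z (negone * x) = coset Z x by rewrite (morphM (coset_morphism Z) (nZ _ Sn) (nZ _
  Sx)) /= (coset_id Zn) mul1g.
apply/setP=> y; case Sy: (y \in S); last by rewrite !inE Sy.
by rewrite -(mem_solvabilizer_coset (groupM Sn Sx) Sy) -(mem_solvabilizer_coset Sx Sy) e.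
Qed.

Lemma solvabilizer_cases x y : x \in S :\: Z -> y \in Sol x ->
  (exists2 a, a \in S :\: Z & x \in 'N('C_S[a]) /\ y \in 'N('C_S[a])) \/
  (exists2 D, quaternion_frame S D & x \in 'N(D) /\ y \in 'N(D)).
Proof.
case/setDP=> Sx nZx; rewrite inE => /andP[Sy sol].
have Hx : x \in <<[set x; y]>> by rewrite mem_gen ?set21.
have Hy : y \in <<[set x; y]>> by rewrite mem_gen ?set22.
have sHS : <<[set x; y]>> \subset S by rewrite gen_subG subUset !sub1set Sx.
have nsub : ~~ (<<[set x; y]>> \subset Z) by apply/subsetPn; exists x.
have [[a nca /subsetP sN]|[D frD /subsetP sN]] := solvable_structure cA sHS sol nsub.
  by left; exists a => //; split; apply: sN.
by right; exists D => //; split; apply: sN.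
Qed.

Definition generic x := [&& x \in S :\: Z, x ^+ 3 \notin Z & x ^+ 4 \notin Z].

(** [frame_expg] rules out a frame normalized by [y]. If [y] normalizes a torus without lying in it,
    its square is central, which is excluded too; so the torus is C(y). A unipotent centralizer
    leads to a common line. *)
Lemma solvabilizer_genericP x y : generic y -> x \in S ->
  x \in Sol y <-> x \in 'N('C_S[y]) \/ exists2 v, v != 0%R & x \in line_stab v /\ y \in line_stab v.
Proof.
case/and3P=> ncy y3 y4 Sx; have Sy := noncentral_SL2 ncy; split; last first.
  case=> [Nx | [v nzv [vx vy]]]; last exact: mem_solvabilizer (line_stab_solvable nzv) vy vx.
  apply: (mem_solvabilizer _ (norm_cent1_solvable ncy)); rewrite // inE ?Sy ?Sx //.
  by apply: (subsetP (normG _)); rewrite in_setI Sy; apply/cent1P.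
case/(solvabilizer_cases ncy) => [[a nca [Ny Nx]] | [D frD [Ny Nx]]]; last first.
  have [h | [_ h]] := frame_expg cZ cA frD Sy Ny; by [rewrite h in y3 | rewrite h in y4].
have [t4 | nt4] := eqVneq (tr a ^+ 2)%R 4%R.
  have [v nzv [_ /subsetP sub]] := norm_unipotent_sub nca t4.
  by right; exists v => //; split; apply: sub; apply/setIP.
left; have [/setIP[_ /cent1P cya] | [_ y2 _]] := norm_torus nca nt4 Sy Ny.
  by rewrite (cent1_eq cA ncy nca cya).
by case/negP: y4; rewrite (expgM _ 2 2) groupX.
Qed.

Lemma solvabilizer_generic x y : generic x -> generic y -> 'C_S[x] = 'C_S[y] -> Sol x = Sol y.
Proof.
move=> gx gy eqC; have /and3P[ncx _ _] := gx; have /and3P[ncy _ _] := gy.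
have Cyx : y \in 'C_S[x] by rewrite eqC in_setI (noncentral_SL2 ncy); apply/cent1P.
have Cxy : x \in 'C_S[y] by rewrite -eqC in_setI (noncentral_SL2 ncx); apply/cent1P.
apply/setP=> g; case Sg: (g \in S); last by rewrite !inE Sg.
apply/idP/idP.
  case/(solvabilizer_genericP gx Sg) => [Ng | [v nzv [vg vx]]]; apply/(solvabilizer_genericP gy Sg).
    by left; rewrite -eqC.
  by right; exists v => //; split; rewrite // (line_stab_cent1 ncx vx).
case/(solvabilizer_genericP gy Sg) => [Ng | [v nzv [vg vx]]]; apply/(solvabilizer_genericP gx Sg).
  by left; rewrite eqC.
by right; exists v => //; split; rewrite // (line_stab_cent1 ncy vx).
Qed.

Lemma solvabilizer_same_trace x y : x \in S :\: Z -> y \in 'C_S[x] ->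
  (tr y ^+ 2 = tr x ^+ 2)%R -> (tr x ^+ 2 != 4)%R -> Sol y = Sol x.
Proof.
move=> ncx Cy /eqP tyx nt4; have Sx := noncentral_SL2 ncx; have dx := elimT (SLP x) Sx.
have main z : z \in 'C_S[x] -> tr z = tr x -> Sol z = Sol x.
  move=> Cz tz; have [Sz _] := setIP Cz; have [a [b zE]] := elimT (cent1_SL2P ncx Sz) Cz.
  have := elimT (SLP z) Sz; rewrite zE in tz * => dz.
  have [e|e] := linear2_same_trace two_neq0 dx nt4 dz tz; rewrite -zE in e.
    by rewrite (mx_inj e).
  by rewrite (_ : z = x^-1) ?solvabilizerV //; apply: mx_inj; rewrite e mxV.
move: tyx; rewrite eqf_sqr => /orP[]/eqP ty; first exact: main.
have Sy : y \in S by have [] := setIP Cy.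
rewrite -(solvabilizer_negone Sy); apply: main; last by rewrite trN ty opprK.
by rewrite groupM // in_setI negone_SL2; apply/cent1P/(cz cZ).
Qed.
Lemma genericP x : x \in S :\: Z ->
  generic x = [&& tr x != 0, tr x ^+ 2 != 1 & tr x ^+ 2 != 2]%R.
Proof.
move=> ncx; rewrite /generic ncx expg3_center // expg4_center // negb_or /=.
by rewrite andbCA.
Qed.

Lemma two_lt4 : (4 != 2 :> F)%R /\ (4 != 1 :> F)%R.
Proof.
split; rewrite -subr_eq0.
  by rewrite (_ : 4 - 2 = 2)%R //; ring.
by rewrite (_ : 4 - 1 = 3)%R //; ring.
Qed.

Lemma generic_unipotent x : x \in S :\: Z -> (tr x ^+ 2 = 4)%R -> generic x.
Proof.
move=> ncx t4; rewrite genericP // t4; have [-> ->] := two_lt4; rewrite !andbT.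
apply: contra_eq_neq t4 => ->; rewrite expr0n /= eq_sym (_ : 4 = 2 ^+ 2)%R; last by ring.
by rewrite expf_neq0.
Qed.

(** For the transvection [1 + transvector v] both alternatives of [solvabilizer_genericP] reduce to
    its unique fixed line. *)
Lemma exists_unipotent v : v != 0%R ->
  exists2 u, [/\ u \in S :\: Z, generic u & u \in line_stab v] &
    {in S, forall x, (x \in Sol u) = (x \in line_stab v)}.
Proof.
move=> nzv; have [u Su uE] : exists2 u, u \in S & mx u = (1%:M + transvector v)%R.
  by apply: exists_SL2; rewrite /transvector !lin2E; ring.
have tu : (tr u = 2)%R by rewrite uE /transvector !lin2E; ring.
have t4 : (tr u ^+ 2 = 4)%R by rewrite tu; ring.
have ncu : u \in S :\: Z.
  apply/setDP; split=> //; apply/negP=> /(SL2_scalarP Su)[l]; rewrite uE => e.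
  have := congr1 (fun M : 'M[F]_2 => M 0 1)%R e; have := congr1 (fun M : 'M[F]_2 => M 1 0)%R e.
  rewrite /transvector /= !lin2E !add0r => /eqP; rewrite sqrf_eq0 => /eqP v0 /eqP.
  rewrite oppr_eq0 sqrf_eq0 => /eqP v1; case/eqP: nzv.
  by apply: rv2P; rewrite mxE.
have vu : u \in line_stab v.
  apply/line_stabP; split=> //; exists 1%R; rewrite scale1r uE mulmxDr mulmx1 /transvector.
  by mx2_ring.
have gu := generic_unipotent ncu t4.
exists u => // x Sx; apply/idP/idP => [/(solvabilizer_genericP gu Sx) | vx]; last first.
  by apply/(solvabilizer_genericP gu Sx); right; exists v.
have in_v w : w != 0%R -> u \in line_stab w -> line_stab w \subset line_stab v.
  by move=> nzw wu; apply: line_stab_subset => //; apply: unipotent_line nzv nzw ncu t4 vu wu.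
case=> [Nx | [w nzw [wx wu]]]; last exact: subsetP (in_v w nzw wu) x wx.
have [w nzw [wu /subsetP sub]] := norm_unipotent_sub ncu t4.
by apply: (subsetP (in_v w nzw wu)); apply: sub; apply/setIP.
Qed.

(** By [exists_unipotent], [x] and [x'] fix the same lines. With two lines they are simultaneously
    diagonal; with one line both are unipotent up to sign. Either way they commute. *)
Lemma solvabilizer_eq_line x x' v : x \in S :\: Z -> x' \in S :\: Z -> Sol x = Sol x' ->
  v != 0%R -> x \in line_stab v -> 'C_S[x] = 'C_S[x'].
Proof.
move=> ncx ncx' eqSol nzv vx; have Sx := noncentral_SL2 ncx; have Sx' := noncentral_SL2 ncx'.
have eq_w w : w != 0%R -> (x \in line_stab w) = (x' \in line_stab w).
  move=> nzw; have [u [ncu _ _] Solu] := exists_unipotent nzw; have Su := noncentral_SL2 ncu.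
  by rewrite -!Solu // solvabilizer_sym // eqSol -solvabilizer_sym.
have vx' : x' \in line_stab v by rewrite -eq_w.
have nz w : ~~ (w <= v)%MS -> w != 0%R by apply: contraNneq => ->; apply: sub0mx.
apply: (cent1_eq cA) => //.
have [tx | [w [nwv wx]]] := line_stab_split nzv ncx vx; last first.
  by apply: (two_line_stabs_commute nzv nwv); rewrite // -eq_w // nz.
have [tx' | [w [nwv wx']]] := line_stab_split nzv ncx' vx'; last first.
  by apply: (two_line_stabs_commute nzv nwv); rewrite // eq_w // nz.
exact: unipotent_commute nzv tx tx' vx vx'.
Qed.

(** * Anticommuting pairs and tetrahedral subgroups *)

Lemma solvable_norm_join (x : gT) (N : {group gT}) : solvable N -> x \in 'N(N) ->
  solvable (N <*> <[x]>).
Proof.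
move=> solN Nx; have nN : <[x]> \subset 'N(N) by rewrite cycle_subG.
have nsN : N <| N <*> <[x]> by rewrite /normal joing_subl join_subG normG.
by rewrite (series_sol nsN) solN /= quotientYidl // quotient_sol // abelian_sol ?cycle_abelian.
Qed.

Lemma solvable_commg_center a b : a \in S -> b \in S -> [~ a, b] \in Z ->
  solvable <<[set a; b]>>.
Proof.
move=> Sa Sb Zab; have nZ g : g \in S -> g \in 'N(Z) by apply: subsetP (gFnorm _ _) g.
rewrite -(solvable_gen_coset Sa Sb); apply/abelian_sol; rewrite abelian_gen.
have cab : commute (coset Z a) (coset Z b).
  apply/commgP; rewrite -(morphR (coset_morphism Z) (nZ _ Sa) (nZ _ Sb)).
  exact/eqP/coset_id.
by apply/centsP=> _ /set2P[]-> _ /set2P[]-> //; apply: commute_sym.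
Qed.

Lemma norm_gen2 x a b : a ^ x \in <<[set a; b]>> -> b ^ x \in <<[set a; b]>> ->
  x \in 'N(<<[set a; b]>>).
Proof.
move=> ax bx; rewrite inE -genJ gen_subG; apply/subsetP=> _ /imsetP[y /set2P[]-> ->] //.
Qed.

Lemma commg_negoneE g h : g \in S -> h \in S -> [~ g, h] = negone -> g ^ h = negone * g.
Proof. by move=> Sg Sh e; rewrite conjg_mulR e (cz cZ Sg). Qed.

Lemma conj_negone_commg g h : g \in S -> h \in S -> g ^ h = negone * g -> [~ g, h] = negone.
Proof. by move=> Sg Sh e; rewrite commgEl e (cz cZ Sg) mulKg. Qed.

Lemma tr_eqN0 (t : F) : (t = - t)%R -> t = 0%R.
Proof.
move/eqP; rewrite -subr_eq0 opprK -mulr2n -mulr_natl mulf_eq0 (negPf two_neq0) /=.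
by move/eqP.
Qed.

(** Each of [g], [h], [g * h] is conjugate to its negative. *)
Lemma commg_negone_tr g h : g \in S -> h \in S -> [~ g, h] = negone ->
  [/\ tr g = 0%R, tr h = 0%R & tr (g * h) = 0%R].
Proof.
move=> Sg Sh e; have gh := commg_negoneE Sg Sh e.
have zz : negone^-1 = negone by apply/eqP; rewrite eq_invg_mul (z2 cZ).
have e' : [~ h, g] = negone by rewrite -invg_comm e zz.
have hg := commg_negoneE Sh Sg e'.
split; apply: tr_eqN0; first by rewrite -[in LHS](trJ g h) gh trN.
  by rewrite -[in LHS](trJ h g) hg trN.
by rewrite -[in LHS](trJ (g * h) h) conjMg gh conjgE mulKg -mulgA trN.
Qed.

(** For matrices of trace 0, Cayley-Hamilton polarizes to: [a b + b a] is the scalar [tr (a b)]. *)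
Lemma tr0_commg_negone a b : a \in S -> b \in S -> tr a = 0%R -> tr b = 0%R ->
  tr (a * b) = 0%R -> [~ a, b] = negone.
Proof.
move=> Sa Sb ta tb tab.
have : (mx (a * b) = - mx (b * a))%R.
  move: ta tb tab; rewrite !mxM !lin2E => ta tb tab.
  have ea : (mx a 1 1 = - mx a 0 0)%R by apply/eqP; rewrite -addr_eq0 addrC ta.
  have eb : (mx b 1 1 = - mx b 0 0)%R by apply/eqP; rewrite -addr_eq0 addrC tb.
  move: tab; rewrite ea eb => tab.
  apply: mx2P; rewrite !lin2E ?ea ?eb; try ring.
    by apply/eqP; rewrite -subr_eq0 opprK -[X in _ == X]tab; apply/eqP; ring.
  by apply/eqP; rewrite -subr_eq0 opprK -[X in _ == X]tab; apply/eqP; ring.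
rewrite -mx_negoneM => /mx_inj e.
by rewrite commgEl conjgE e (cz cZ) ?groupM // !mulgA mulgKV mulVg mul1g.
Qed.

Lemma sqr_tr0 a : a \in S -> tr a = 0%R -> a * a = negone.
Proof.
move=> Sa ta; apply: mx_inj; rewrite mxM Cayley_Hamilton2 ta (elimT (SLP a) Sa) mx_negone.
by rewrite scale0r sub0r raddfN.
Qed.

Lemma tr0_notinZ a : a \in S -> tr a = 0%R -> a \in S :\: Z.
Proof.
move=> Sa ta; apply/setDP; split=> //; apply/negP; rewrite cZ !inE => /orP[]/eqP e.
  by move/eqP: ta; rewrite e mx1 mxtrace1 (negPf two_neq0).
by move/eqP: ta; rewrite e mx_negone mxtrace_scalar mulNrn oppr_eq0 (negPf two_neq0).
Qed.

Lemma cent1_negoneM x : 'C_S[negone * x] = 'C_S[x].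
Proof.
apply/setP=> y; rewrite !in_setI; case Sy: (y \in S) => //=.
have cy := cz cZ Sy.
apply/cent1P/cent1P => [e | e]; last by apply: commuteM => //; apply: commute_sym.
by apply: (mulgI negone); rewrite !mulgA -[RHS]e mulgA cy.
Qed.

(** A matrix [B] from [exists_anticommuting] conjugates [x] to its inverse, and so does any
    invertible multiple of it by F[x]; the norm form represents the factor needed to reach
    determinant 1. *)
Lemma exists_inverting x : x \in S :\: Z -> (tr x ^+ 2 != 4)%R ->
  exists2 w, w \in S & x ^ w = x^-1.
Proof.
move=> ncx nt4; have Sx := noncentral_SL2 ncx; have dx := elimT (SLP x) Sx.
have [B [tB txB dB xB]] := exists_anticommuting (SL2_nonscalar ncx).
have [a [b ab]] := norm_form_repr two_neq0 (\det B)^-1%R nt4.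
have [w Sw wE] : exists2 w, w \in S & mx w = ((a%:M + b *: mx x) *m B)%R.
  by apply: exists_SL2; rewrite det_mulmx det_linear2 dx mulr1 ab mulVf.
exists w => //; suff e : x * w = w * x^-1 by rewrite conjgE e mulKg.
apply: mx_inj; rewrite !mxM mxV // wE -(mulmxA _ B) -xB !mulmxA; congr (_ *m _)%R.
by rewrite mulmxDl mulmxDr scalar_mxC -scalemxAl -scalemxAr.
Qed.

(* The conjugates of a under x are three pairwise anticommuting elements. *)
Lemma exists_tetrahedral x : x \in S :\: Z -> tr x = 1%R ->
  exists a, [/\ a \in Sol x, [~ a, a ^ x] = negone & tr (a * x) = (-1)%R].
Proof.
move=> ncx t1; have Sx := noncentral_SL2 ncx; have dx := elimT (SLP x) Sx.
have [B [tB txB dB xB]] := exists_anticommuting (SL2_nonscalar ncx).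
have nt4 : (tr x ^+ 2 != 4)%R by rewrite t1 expr1n eq_sym; case: two_lt4.
(* The component of [a] in F[x] must be [- 1 / 3 + 2 / 3 x], the only one with trace 0 and
   [tr (a * x) = - 1]. Its determinant is 1 / 3, which leaves 2 / 3 for the component in F[x] B. *)
have [k [l kl]] := norm_form_repr two_neq0 (2 / 3 / \det B)%R nt4; rewrite t1 in kl.
have trB i j : (\tr ((i%:M + j *: mx x) *m B) = 0)%R.
  by rewrite mulmxDl linearD /= mul_scalar_mx linearZ /= tB mulr0 -scalemxAl linearZ /= txB mulr0
    addr0.
have tP : (\tr ((- 3^-1)%:M + (2 / 3) *: mx x) = 0)%R.
  by rewrite mxtrace_linear2 t1; field.
have [a Sa aE] : exists2 a, a \in S & mx a =
    ((- 3^-1)%:M + (2 / 3) *: mx x + (k%:M + l *: mx x) *m B)%R.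
  apply: exists_SL2; rewrite det_add2 tP mul0r addr0 mulmxA mul_linear2 trB subr0.
  rewrite det_mulmx !det_linear2 dx t1 [(l ^+ 2 * 1)%R]mulr1 kl divfK //.
  by field.
have ta : tr a = 0%R by rewrite aE linearD /= tP trB addr0.
have tax : tr (a * x) = (-1)%R.
  rewrite mxM mxtrace_mulC aE mulmxDr linearD /= mulmxA.
  have -> : (mx x *m (k%:M + l *: mx x) = (- l)%:M + (k + l) *: mx x)%R.
    by rewrite mulmxDr mul_mx_scalar -scalemxAr Cayley_Hamilton2 t1 dx; mx2_ring.
  rewrite trB addr0 mulmxDr mul_mx_scalar linearD /= linearZ /= -scalemxAr linearZ /=.
  rewrite Cayley_Hamilton2 linearB linearZ /= t1 dx mxtrace_scalar.
  by field.
have [b bE] : exists b, b = a ^ x by exists (a ^ x).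
have Sb : b \in S by rewrite bE groupJ.
have tb : tr b = 0%R by rewrite bE trJ.
have tab : tr (a * b) = 0%R.
  (* As [x^-1 = 1 - x] and [a * a = - 1], the product is [- x - (a x) ^+ 2], of trace
     [- 1 - (1 - 2) = 0]. *)
  have -> : a * b = (a * x^-1) * (a * x) by rewrite bE conjgE !mulgA.
  have -> : (mx (a * x^-1 * (a * x)) = - mx x - mx (a * x) *m mx (a * x))%R.
    rewrite mxM [mx (a * x^-1)]mxM mxV // t1 mulmxBr mulmx1 mulmxBl -!mxM mulgA.
    by rewrite (sqr_tr0 Sa ta) mx_negoneM.
  rewrite Cayley_Hamilton2 (elimT (SLP _) (groupM Sa Sx)) tax !linearB linearN /= t1.
  by rewrite linearZ /= tax mxtrace_scalar; ring.
have cab := tr0_commg_negone Sa Sb ta tb tab.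
exists a; rewrite -bE; split=> //.
have [c cE] : exists c, c = b ^ x by exists (b ^ x).
have Sc : c \in S by rewrite cE groupJ.
have x3 : x ^+ 3 \in Z by rewrite expg3_center // t1 expr1n.
have cx : c ^ x = a.
  have -> : c ^ x = a ^ (x ^+ 3) by rewrite cE bE !expgS expg0 mulg1 !conjgM.
  apply/conjg_fixP/commgP/commute_sym.
  by case/centerP: x3 => _; apply.
have zx : negone ^ x = negone by apply/conjg_fixP/commgP/(cz cZ).
have cbc : [~ b, c] = negone by rewrite -zx -cab conjRg -bE -cE.
have cca : [~ c, a] = negone by rewrite -zx -cbc conjRg cx -cE.
have zV : negone^-1 = negone by apply/eqP; rewrite eq_invg_mul (z2 cZ).
(* Pairwise anticommutation makes [a * b * c] commute with [a] and [b], so it is central; this puts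
   [c] in the group generated by [a] and [b], which [x] therefore normalizes. *)
have abc : a * b * c \in Z.
  have [caabc cbabc] : commute a (a * b * c) /\ commute b (a * b * c).
    have ab := commg_negoneE Sa Sb cab; have bc := commg_negoneE Sb Sc cbc.
    have ca := commg_negoneE Sc Sa cca.
    have ba : b ^ a = negone * b by apply: commg_negoneE => //; rewrite -invg_comm cab.
    have cb : c ^ b = negone * c by apply: commg_negoneE => //; rewrite -invg_comm cbc.
    have zz g : negone * (negone * g) = g by rewrite mulgA (z2 cZ) mul1g.
    have Sn := negone_SL2.
    have nM g h : g \in S -> g * (negone * h) = negone * (g * h).
      by move=> Sg; rewrite !mulgA (cz cZ Sg).
    split; apply/commute_sym/commgP/conjg_fixP; rewrite !conjMg.
      have -> : a ^ a = a by rewrite conjgE mulKg.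
      by rewrite ba ca !nM ?groupM // -!mulgA zz.
    have -> : b ^ b = b by rewrite conjgE mulKg.
    by rewrite ab cb !nM ?groupM // -!mulgA zz.
  apply: contraT => nZ; have nc : a * b * c \in S :\: Z by rewrite inE nZ !groupM.
  have := commute_trans cA nc Sa Sb (commute_sym caabc) (commute_sym cbabc).
  by move/commgP; rewrite cab (negPf negone_neq1).
have Dc : c \in <<[set a; b]>>.
  have Da : a \in <<[set a; b]>> by rewrite mem_gen ?set21.
  have Db : b \in <<[set a; b]>> by rewrite mem_gen ?set22.
  have Dz : negone \in <<[set a; b]>> by rewrite -cab groupR.
  rewrite -(groupMl _ (groupM Da Db)).
  by move: abc; rewrite cZ !inE => /orP[]/eqP->; rewrite ?group1.
have Nx : x \in 'N(<<[set a; b]>>) by apply: norm_gen2; rewrite -?bE -?cE // mem_gen ?set22.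
have solD : solvable <<[set a; b]>>.
  by apply: solvable_commg_center; rewrite // cab cZ !inE eqxx orbT.
apply: (mem_solvabilizer Sa (solvable_norm_join solD Nx)).
  by rewrite mem_gen // inE cycle_id orbT.
by rewrite mem_gen // inE mem_gen ?set21.
Qed.

(** * Orders of centralizers and of their elements *)

Hypothesis card_F_gt10 : 10 < #|F|.
Hypothesis card_F_3 : ~~ (3 %| #|F|).
Local Notation q := #|F|.
Local Notation disc x := (tr x ^+ 2 - 4)%R.

Lemma card_cent1 x : x \in S :\: Z -> #|'C_S[x]| = #|norm_one (tr x)|.
Proof.
move=> ncx; have Sx := noncentral_SL2 ncx; have dx := elimT (SLP x) Sx.
pose f (u : F * F) := (u.1%:M + u.2 *: mx x)%R.
have inj_f : injective f.
  by move=> [a b] [c d]; rewrite /f /= => /(linear2_inj (SL2_nonscalar ncx))[-> ->].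
rewrite -(card_imset _ mx_inj) -(card_imset _ inj_f); apply: eq_card => A.
apply/imsetP/imsetP => [[y Cy ->] | [[a b]]].
  have [Sy _] := setIP Cy; have [a [b yE]] := elimT (cent1_SL2P ncx Sy) Cy.
  exists (a, b); rewrite // inE /= -[X in _ == X](elimT (SLP y) Sy) yE det_linear2 dx mulr1.
  by [].
rewrite inE /= => /eqP ab ->; have [y Sy yE] : exists2 y, y \in S & mx y = f (a, b).
  by apply: exists_SL2; rewrite /f det_linear2 dx mulr1.
by exists y => //; apply/(cent1_SL2P ncx Sy); exists a, b.
Qed.

Lemma card_torus x : x \in S :\: Z -> (tr x ^+ 2 != 4)%R ->
  (#|'C_S[x]| + nsqrt (disc x) = q + 1)%N.
Proof. by move=> ncx nt4; rewrite card_cent1 // card_norm_one. Qed.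

Lemma card_cent1_unipotent x : x \in S :\: Z -> (tr x ^+ 2 = 4)%R -> #|'C_S[x]| = (2 * q)%N.
Proof. by move=> ncx t4; rewrite card_cent1 // card_norm_one_degenerate. Qed.

(** For a given diagonal [(a, t - a)] the other two entries lie on a hyperbola, which degenerates
    when [a * (t - a) = 1], that is when [2 a - t] is a square root of [t ^+ 2 - 4]. *)
Lemma card_SL2_trace (t : F) :
  #|[set x in S | tr x == t]| = (q * q.-1 + q * nsqrt (t ^+ 2 - 4)%R)%N.
Proof.
pose e (a : F) := (a * (t - a) - 1)%R.
pose P := [set u : F * (F * F) | (u.2.1 * u.2.2 == e u.1)%R].
pose f (u : F * (F * F)) := mx2 u.1 u.2.1 u.2.2 (t - u.1)%R.
have inj_f : injective f.
  move=> [a [b c]] [a' [b' c']] /matrixP ef.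
  by have := ef 0%R 0%R; have := ef 0%R 1%R; have := ef 1%R 0%R; rewrite !lin2E /= => -> -> ->.
have -> : #|[set x in S | tr x == t]| = #|P|.
  rewrite -(card_imset _ mx_inj) -(card_imset _ inj_f); apply: eq_card => A.
  apply/imsetP/imsetP => [[x] | [[a [b c]]]].
    rewrite inE => /andP[/SLP dx /eqP tx] ->; exists (mx x 0 0, (mx x 0 1, mx x 1 0))%R.
      rewrite inE /= /e -dx -tx !lin2E; apply/eqP; ring.
    by rewrite /f /= -tx; apply: mx2P; rewrite !lin2E //; ring.
  rewrite inE /= => /eqP bc ->; have [x Sx xE] : exists2 x, x \in S & mx x = f (a, (b, c)).
    by apply: exists_SL2; rewrite /f /= !lin2E bc /e; ring.
  by exists x; rewrite // inE Sx xE /f /= !lin2E; apply/eqP; ring.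
have -> : #|P| = (\sum_(a : F) \sum_(u : F * F | (u.1 * u.2 == e a)%R) 1)%N.
  by rewrite pair_big_dep /= /P sum1dep_card.
have -> : (q * q.-1 + q * nsqrt (t ^+ 2 - 4)%R = \sum_(a : F) (q.-1 + (e a == 0)%R * q))%N.
  rewrite big_split /= sum_nat_const -big_distrl /= [(q * nsqrt _)%N]mulnC; congr (_ + _ * _)%N.
  have inj_g : injective (fun a : F => (2 * a - t)%R).
    by move=> a b /addIr /(mulfI two_neq0).
  rewrite /nsqrt -(card_preimset _ inj_g) -sum1_card big_mkcond; apply: eq_bigr => a _.
  rewrite !inE /e -subr_eq0.
  have -> : ((2 * a - t) ^+ 2 - (t ^+ 2 - 4) = - 4 * (a * (t - a) - 1))%R by ring.
  by rewrite mulf_eq0 oppr_eq0 (negPf (four_neq0 two_neq0)) /=; case: (_ == _).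
by apply: eq_bigr => a _; rewrite sum1dep_card card_hyperbola.
Qed.

(** Replacing [x] by an eigenvalue [l] in an algebraic closure embeds C(x) into the multiplicative
    group of a field, whether or not [l] lies in F. *)
Lemma torus_cyclic x : x \in S :\: Z -> (tr x ^+ 2 != 4)%R -> cyclic 'C_S[x].
Proof.
move=> ncx nt4; have Sx := noncentral_SL2 ncx; have dx := elimT (SLP x) Sx.
have [L [phi _]] := countable_algebraic_closure F.
pose t := tr x.
have [l el] := @solve_monicpoly L 2 (fun i => if i == 0%N then (-1)%R else phi t) isT.
have {}el : (l ^+ 2 = phi t * l - 1)%R.
  by rewrite el !big_ord_recl big_ord0 /= addr0 expr0 expr1; ring.
have nz : (4 - t ^+ 2 != 0)%R by rewrite subr_eq0 eq_sym.
(* [ac g] and [bc g] are the coordinates of [g] on 1 and [x], solved from [tr g] and [tr (g * x)] so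
   as to be defined for every [g]. *)
pose bc g := ((t * tr g - 2 * tr (g * x)) / (4 - t ^+ 2))%R.
pose ac g := ((tr g - bc g * t) / 2)%R.
have coef g (a b : F) : mx g = (a%:M + b *: mx x)%R -> ac g = a /\ bc g = b.
  move=> gE; have tgx : tr (g * x) = (a * t + b * (t ^+ 2 - 2))%R.
    rewrite mxM gE mulmxDl mul_scalar_mx -scalemxAl Cayley_Hamilton2 dx.
    by rewrite linearD !linearZ /= linearB linearZ /= mxtrace_scalar -/t; ring.
  have bE : bc g = b.
    by rewrite /bc tgx gE mxtrace_linear2 -/t; field.
  by split=> //; rewrite /ac bE gE mxtrace_linear2 -/t; field.
apply: (@field_mul_group_cyclic _ _ L (fun g => phi (ac g) + phi (bc g) * l)%R).
  move=> g h Cg Ch; have [Sg _] := setIP Cg; have [Sh _] := setIP Ch.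
  have [a [b gE]] := elimT (cent1_SL2P ncx Sg) Cg.
  have [c [d hE]] := elimT (cent1_SL2P ncx Sh) Ch.
  have [-> ->] := coef _ _ _ gE; have [-> ->] := coef _ _ _ hE.
  have ghE : mx (g * h) = ((a * c - b * d)%:M + (a * d + b * c + b * d * t) *: mx x)%R.
    by rewrite mxM gE hE mul_linear2 dx mulr1.
  have [-> ->] := coef _ _ _ ghE; rewrite !rmorphD rmorphN !rmorphM.
  have -> : ((phi a + phi b * l) * (phi c + phi d * l) = phi a * phi c + (phi a * phi d + phi b *
    phi c) * l + phi b * phi d * l ^+ 2)%R by ring.
  by rewrite el; ring.
move=> g Cg; have [Sg _] := setIP Cg; have [a [b gE]] := elimT (cent1_SL2P ncx Sg) Cg.
have [-> ->] := coef _ _ _ gE; split=> [e1 | g1]; last first.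
  have e : mx g = (1%:M + 0 *: mx x)%R by rewrite g1 mx1 scale0r addr0.
  by rewrite e in gE; have [<- <-] := linear2_inj (SL2_nonscalar ncx) gE;
    rewrite rmorph1 rmorph0 mul0r addr0.
have nab : (a ^+ 2 + a * b * t + b ^+ 2 = 1)%R.
  by have := elimT (SLP g) Sg; rewrite gE det_linear2 dx mulr1.
(* The values at the two eigenvalues [l] and [t - l] have product 1, so both are 1; the eigenvalues
   being distinct, [b = 0]. *)
have e2 : (phi a + phi b * (phi t - l) = 1)%R.
  have : ((phi a + phi b * l) * (phi a + phi b * (phi t - l)) = 1)%R.
    have -> : ((phi a + phi b * l) * (phi a + phi b * (phi t - l)) = phi a ^+ 2 + phi a * phi b *
      phi t + phi b ^+ 2 * (phi t * l - l ^+ 2))%R by ring.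
    have pn : (phi a ^+ 2 + phi a * phi b * phi t + phi b ^+ 2 = 1)%R.
      by rewrite -!rmorphXn -!rmorphM -!rmorphD nab rmorph1.
    by rewrite el -[RHS]pn; ring.
  by rewrite e1 mul1r.
have b0 : b = 0%R.
  have : (phi b * (2 * l - phi t) = 0)%R.
    have -> : (phi b * (2 * l - phi t) = (phi a + phi b * l) - (phi a + phi b * (phi t - l)))%R by
      ring.
    by rewrite e1 e2 subrr.
  move/eqP; rewrite mulf_eq0 fmorph_eq0 => /orP[/eqP // | ]; rewrite -sqrf_eq0.
  have -> : ((2 * l - phi t) ^+ 2 = 4 * l ^+ 2 - 4 * (phi t * l) + phi t ^+ 2)%R by ring.
  have -> : (4 * l ^+ 2 - 4 * (phi t * l) + phi t ^+ 2 = phi (- (4 - t ^+ 2)))%R.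
    by rewrite el rmorphN rmorphB rmorphXn rmorph_nat; ring.
  by rewrite fmorph_eq0 oppr_eq0 (negPf nz).
have a1 : a = 1%R by apply: (fmorph_inj phi); rewrite rmorph1 -e1 b0 rmorph0 mul0r addr0.
by apply: mx_inj; rewrite gE a1 b0 scale0r addr0 mx1.
Qed.

Lemma card_F_odd : odd q.
Proof. have [<- _] := card_split_traces two_neq0; by rewrite oddD oddM. Qed.

Lemma center_sqr g : g \in Z -> g ^+ 2 = 1.
Proof. by rewrite cZ !inE expgS expg1 => /orP[]/eqP->; rewrite ?mulg1 // (z2 cZ). Qed.

Lemma involution_center g : g \in S -> g ^+ 2 = 1 -> g \in Z.
Proof.
move=> Sg g2; apply: contraT => nZ; have ncg : g \in S :\: Z by rewrite inE nZ.
have := expg2_SL2 Sg; rewrite g2 mx1 -[LHS]addr0 -(scale0r (mx g)) => e.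
have [/eqP] := linear2_inj (SL2_nonscalar ncg) e.
by rewrite (negPf char2_neq).
Qed.

Lemma order_2pow (g : gT) k : g ^+ (2 ^ k) != 1 -> g ^+ (2 ^ k.+1) = 1 -> #[g] = (2 ^ k.+1)%N.
Proof.
move=> n1 /eqP; rewrite -order_dvdn => /(dvdn_pfactor _ _ (isT : prime 2))[m lem e].
rewrite e; congr (_ ^ _)%N; apply/eqP; rewrite eqn_leq lem ltnNge.
by apply: contra n1 => lemk; rewrite -order_dvdn e dvdn_exp2l.
Qed.

Lemma order_trace0 g : g \in S -> #[g] = 4 -> g \in S :\: Z /\ tr g = 0%R.
Proof.
move=> Sg og; have n2 : g ^+ 2 != 1 by rewrite -order_dvdn og.
have ncg : g \in S :\: Z by apply/setDP; split=> //; apply: contra n2 => /center_sqr ->.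
split=> //; apply/eqP; rewrite -expg2_center //; apply: involution_center; first exact: groupX.
by rewrite -expgM; apply/eqP; rewrite -order_dvdn og.
Qed.

Lemma order_trace1 g : g \in S -> #[g] = 3 -> g \in S :\: Z /\ (tr g ^+ 2 = 1)%R.
Proof.
move=> Sg og; have n2 : g ^+ 2 != 1 by rewrite -order_dvdn og.
have ncg : g \in S :\: Z by apply/setDP; split=> //; apply: contra n2 => /center_sqr ->.
by split=> //; apply/eqP; rewrite -expg3_center // -og expg_order group1.
Qed.

Lemma order_trace2 g : g \in S -> #[g] = 8 -> g \in S :\: Z /\ (tr g ^+ 2 = 2)%R.
Proof.
move=> Sg og; have n2 : g ^+ 2 != 1 by rewrite -order_dvdn og.
have ncg : g \in S :\: Z by apply/setDP; split=> //; apply: contra n2 => /center_sqr ->.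
split=> //; have : g ^+ 4 \in Z.
  apply: involution_center; first exact: groupX.
  by rewrite -expgM; apply/eqP; rewrite -order_dvdn og.
rewrite expg4_center // => /orP[|/eqP //]; rewrite -expg2_center // => /center_sqr/eqP.
by rewrite -expgM -order_dvdn og.
Qed.

Lemma trace0_order g : g \in S :\: Z -> tr g = 0%R -> #[g] = 4.
Proof.
move=> ncg t0; have Sg := noncentral_SL2 ncg; have gg := sqr_tr0 Sg t0.
by apply: (@order_2pow g 1); rewrite ?(expgM _ 2 2) !expgS !expg0 ?mulg1 gg ?(z2 cZ) ?negone_neq1.
Qed.

(** The order is 3 or 6 according to the sign of [g]; in both cases [g ^+ 4] has order 3. *)
Lemma trace1_order g : g \in S :\: Z -> (tr g ^+ 2 = 1)%R -> 3 %| #[g].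
Proof.
move=> ncg /eqP t1; have Sg := noncentral_SL2 ncg.
have g3 : g ^+ 3 \in Z by rewrite expg3_center.
have o4 : #[g ^+ 4] = 3.
  apply: nt_prime_order => //.
    by rewrite -expgM (expgM _ 6 2) center_sqr // (expgM _ 3 2) groupX.
  apply: contraTneq ncg => e; rewrite inE negb_and negbK.
  by rewrite -(groupMr _ g3) -expgS e group1.
by rewrite -o4 orderXgcd dvdn_div // dvdn_gcdl.
Qed.

Lemma trace2_order g : g \in S :\: Z -> (tr g ^+ 2 = 2)%R -> #[g] = 8.
Proof.
move=> ncg t2; have Sg := noncentral_SL2 ncg.
have g4 : g ^+ 4 \in Z by rewrite expg4_center // t2 eqxx orbT.
have g2 : g ^+ 2 \notin Z.
  rewrite expg2_center //; apply: contra_eq_neq t2 => ->.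
  by rewrite expr0n /= eq_sym.
apply: (@order_2pow g 2); last by rewrite (expgM _ 4 2) center_sqr.
apply: contra g2 => /eqP e; apply: involution_center; first exact: groupX.
by rewrite -expgM.
Qed.

Lemma torus_neq4 x d : x \in S :\: Z -> d %| #|'C_S[x]| -> d \in [:: 3; 4; 8] -> (tr x ^+ 2 != 4)%R.
Proof.
move=> ncx + dE; apply: contraTneq => t4; rewrite card_cent1_unipotent //.
have o2 : ~~ (4 %| 2 * q)%N by rewrite (@dvdn_pmul2l 2 2 q) // dvdn2 card_F_odd.
move: dE; rewrite !inE => /or3P[]/eqP-> //.
  by rewrite Gauss_dvdr.
by apply: contra o2; apply: dvdn_trans.
Qed.

Lemma torus_element x d : x \in S :\: Z -> d \in [:: 3; 4; 8] -> d %| #|'C_S[x]| ->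
  exists2 y, y \in 'C_S[x] & #[y] = d.
Proof.
move=> ncx dE dT; have /cyclicP[g gE] := torus_cyclic ncx (torus_neq4 ncx dT dE).
rewrite gE -[#|_|]/(#[g]) in dT *; exists (g ^+ (#[g] %/ d)); first exact: mem_cycle.
by rewrite orderXdiv ?dvdn_div // divnA // mulKn // order_gt0.
Qed.

(** As [negone] is the only involution, orders 2 and 4 modulo the centre lift to 4 and 8, while an
    element of order 3 modulo the centre has order 3 up to sign; hence the three pairs. *)
Lemma torus_traceP x c d : x \in S :\: Z -> (c, d) \in [:: (0%R, 4); (1%R, 3); (2%:R%R, 8)] ->
  (exists2 y, y \in S :\: Z & commute x y /\ (tr y ^+ 2 = c)%R) <-> d %| #|'C_S[x]|.
Proof.
move=> ncx cd; split=> [[y ncy [cxy ty]] | dT].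
  have Cy : y \in 'C_S[x] by rewrite in_setI (noncentral_SL2 ncy); apply/cent1P/commute_sym.
  apply: dvdn_trans (order_dvdG Cy).
  rewrite !inE in cd; case/or3P: cd => /eqP[cE ->]; rewrite cE in ty.
  - by rewrite trace0_order //; apply/eqP; rewrite -sqrf_eq0 ty.
  - exact: trace1_order.
  by rewrite trace2_order.
have dE : d \in [:: 3; 4; 8] by move: cd; rewrite !inE => /or3P[]/eqP[_ ->].
have [y Cy oy] := torus_element ncx dE dT; have [Sy /cent1P/commute_sym cxy] := setIP Cy.
suff [ncy ty] : y \in S :\: Z /\ (tr y ^+ 2 = c)%R by exists y.
rewrite !inE in cd; case/or3P: cd => /eqP[-> dd]; rewrite dd in oy.
- by have [ncy ->] := order_trace0 Sy oy; rewrite expr0n.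
- exact: order_trace1.
exact: order_trace2.
Qed.

(** A generator of a torus has order above 8, while a central [g ^+ n] with [n < 5] would make its
    order divide [2 n]. *)
Lemma exists_generic x : x \in S :\: Z -> exists2 y, generic y & commute x y.
Proof.
move=> ncx; have [t4 | nt4] := eqVneq (tr x ^+ 2)%R 4%R.
  by exists x; first exact: generic_unipotent.
have /cyclicP[g gE] := torus_cyclic ncx nt4.
have Cg : g \in 'C_S[x] by rewrite gE cycle_id.
have [Sg /cent1P/commute_sym cxg] := setIP Cg.
have og : 8 < #[g].
  have := card_torus ncx nt4; rewrite gE -[#|_|]/(#[g]).
  by case: (nsqrtP two_neq0) => _; lia.
have notZ n : 0 < n -> n < 5 -> g ^+ n \notin Z.
  move=> n0 n5; apply/negP=> /center_sqr/eqP; rewrite -expgM -order_dvdn => /dvdn_leq; lia.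
exists g => //; rewrite /generic inE Sg andbT -[X in X \notin _]expg1.
by rewrite !notZ.
Qed.

Lemma card_center : #|Z| = 2.
Proof. by rewrite cZ cards2 eq_sym negone_neq1. Qed.

Lemma center_trace x : x \in Z -> (tr x ^+ 2 = 4)%R.
Proof.
rewrite cZ !inE => /orP[]/eqP->; rewrite ?mx1 ?mx_negone mxtrace_scalar; ring.
Qed.

(* The centralizers of unipotent elements (n = 2 q) are included. *)
Definition max_tori n := [set T in [set 'C_S[x] | x in S :\: Z] | #|T| == n].

(** Distinct centralizers share only the centre, so they partition the noncentral elements; each of
    order [n] has [n - 2] of them. *)
Lemma card_max_tori n : (#|max_tori n| * (n - 2))%N = #|[set x in S :\: Z | #|'C_S[x]| == n]|.
Proof.
rewrite -sum_nat_const -[RHS]sum1_card (partition_big (fun x => 'C_S[x]) (mem (max_tori n))) /=.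
  apply: eq_bigr => T; rewrite inE => /andP[/imsetP[x0 ncx0 TE] /eqP cT].
  have <- : #|T :\: Z| = (n - 2)%N.
    rewrite cardsD cT (setIidPr _) ?card_center // TE subsetI center_sub /=.
    by apply/subsetP=> z /centerP[_ zc]; apply/cent1P/zc/(noncentral_SL2 ncx0).
  rewrite -sum1_card; apply: eq_bigl => x.
  apply/setDP/andP => [[Tx nZ] | [/setIdP[ncx _] /eqP <-]].
    have [Sx /cent1P cx] : x \in S /\ x \in 'C[x0] by apply/setIP; rewrite -TE.
    have ncx : x \in S :\: Z by apply/setDP.
    have eC := cent1_eq cA ncx ncx0 cx.
    by rewrite eC -TE eqxx; split=> //; apply/setIdP; rewrite eC -TE cT.
  have [Sx nZ] := setDP ncx; split=> //; rewrite in_setI Sx; exact/cent1P.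
by move=> x /setIdP[ncx cx]; apply/setIdP; split=> //; apply/imsetP; exists x.
Qed.

(* With c = x ^+ 2, e is the element (a + c) / tr x of order 2 modulo the centre, which swaps a
  and c
   by conjugation; x normalizes the group generated by a, c and x * e. *)
Lemma exists_octahedral x : x \in S :\: Z -> (tr x ^+ 2 = 2)%R ->
  exists a e, [/\ a \in S, [~ a, x ^+ 2] = negone, (x ^+ 2) ^ e = a & e \in Sol x].
Proof.
move=> ncx t2; have Sx := noncentral_SL2 ncx; have Sn := negone_SL2.
have nt0 : tr x != 0%R by apply: contra_eq_neq t2 => ->; rewrite expr0n /= eq_sym.
have nt4 : (tr x ^+ 2 != 4)%R by rewrite t2 eq_sym; case: two_lt4.
have x2Z : x ^+ 2 \notin Z by rewrite expg2_center.
have [c cE] : exists c, c = x ^+ 2 by exists (x ^+ 2).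
rewrite -cE in x2Z *; have Sc : c \in S by rewrite cE groupX.
have ncc : c \in S :\: Z by rewrite inE x2Z.
have tc : tr c = 0%R.
  apply/eqP; rewrite -expg2_center // cE -expgM expg4_center // t2 eqxx orbT //.
have cc := sqr_tr0 Sc tc.
have cV : c^-1 = negone * c by apply/eqP; rewrite eq_invg_mul mulgA -(cz cZ Sc) -mulgA cc (z2 cZ).
have ntc : (tr c ^+ 2 != 4)%R.
  by rewrite tc expr0n /= eq_sym (_ : 4 = 2 ^+ 2)%R ?expf_neq0 //; ring.
have [a Sa ca] := exists_inverting ncc ntc; rewrite cV in ca.
have cca := conj_negone_commg Sc Sa ca.
have zV : negone^-1 = negone by apply/eqP; rewrite eq_invg_mul (z2 cZ).
have cac : [~ a, c] = negone by rewrite -invg_comm cca zV.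
have [ta _ tac] := commg_negone_tr Sa Sc cac.
have aa := sqr_tr0 Sa ta.
(* [a] and [c] anticommute, so [a + c] has determinant 2, which is [tr x ^+ 2]. *)
have [e Se eE] : exists2 e, e \in S & mx e = ((tr x)^-1 *: (mx a + mx c))%R.
  apply: exists_SL2; rewrite detZ det_add2 -mxM tac ta mul0r addr0 subr0.
  rewrite (elimT (SLP a) Sa) (elimT (SLP c) Sc) exprVn t2 -[(1 + 1)%R]/(2%:R)%R mulVf //.
have ce : c ^ e = a.
  suff h : c * e = e * a by rewrite conjgE h mulKg.
  apply: mx_inj; rewrite !mxM eE -scalemxAr -scalemxAl; congr (_ *: _)%R.
  by rewrite mulmxDr mulmxDl -!mxM aa cc addrC.
have te : tr e = 0%R by rewrite eE linearZ /= linearD /= ta tc addr0 mulr0.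
have ee := sqr_tr0 Se te.
have ae : a ^ e = c by rewrite -ce -conjgM ee; apply/conjg_fixP/commgP/commute_sym/(cz cZ).
exists a, e; split=> //.
have Da : a \in <<[set a; c]>> by rewrite mem_gen ?set21.
have Dc : c \in <<[set a; c]>> by rewrite mem_gen ?set22.
have solD : solvable <<[set a; c]>>.
  by apply: solvable_commg_center; rewrite // cac cZ !inE eqxx orbT.
have Ne : e \in 'N(<<[set a; c]>>) by apply: norm_gen2; rewrite ?ae ?ce.
have Cxc : commute x c by rewrite cE; apply: commuteX.
have cx : c ^ x = c by apply/conjg_fixP/commgP/commute_sym.
(* [a] normalizes C(c) = C(x) and does not commute with [c = x ^+ 2], so it can only invert [x]. *)
have xa : x ^ a = x^-1.
  have Na : a \in 'N('C_S[x]).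
    by rewrite (cent1_eq cA ncx ncc Cxc) norm_cent1_inv // ca cV.
  have [/setIP[_ /cent1P cax] | [] //] := norm_torus ncx nt4 Sa Na.
  have : commute c a by rewrite cE; apply/commute_sym/commuteX.
  by move/commgP; rewrite cca (negPf negone_neq1).
have ax : a ^ x = c^-1 * a.
  have h : x * a = a * x^-1 by rewrite -xa conjgE mulKVg.
  have h' : a * x = x^-1 * a by apply: (mulgI x); rewrite mulgA h mulgKV mulKVg.
  by rewrite conjgE h' cE expgS expg1 invMg mulgA.
have Nx : x \in 'N(<<[set a; c]>>).
  by apply: norm_gen2; rewrite ?cx // ax groupM ?groupV.
have Dn : negone \in <<[set a; c]>> by rewrite -cac groupR.
have Nu : x * e \in 'N(<<[set a; c]>>) by rewrite groupM.
have solE := solvable_norm_join solD Nu.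
set E := (<<_>> <*> _) in solE.
have sDE : <<[set a; c]>> \subset E by apply: joing_subl.
have Eu : x * e \in E by rewrite mem_gen // inE cycle_id orbT.
(* Since [e * c * e = negone * a], conjugation by [x] sends [x * e] to its inverse up to a factor in
   the group generated by [a] and [c]. *)
have NEx : x \in 'N(E).
  have ux : (x * e) ^ x = negone * a * (x * e)^-1.
    have -> : (x * e) ^ x = e * x by rewrite conjgE -mulgA mulKg.
    apply: (mulIg (x * e)); rewrite mulgKV.
    have -> : e * x * (x * e) = e * (c * e) by rewrite cE expgS expg1 !mulgA.
    by rewrite -ee -mulgA -ce conjgE mulKVg.
  have Exu : (x * e) ^ x \in E.
    by rewrite ux !groupM ?groupV //; apply: (subsetP sDE).
  by rewrite inE /E conjYg join_subG (normP Nx) sDE -cycleJ cycle_subG.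
have solEx := solvable_norm_join solE NEx.
have Hx : x \in E <*> <[x]> by rewrite mem_gen // inE cycle_id orbT.
have Hu : x * e \in E <*> <[x]> by apply: (subsetP (joing_subl _ _)).
by apply: (mem_solvabilizer Se solEx Hx); rewrite -(groupMl _ Hx).
Qed.

(* If x' has order 4 modulo the centre, a frame normalized by x' and a contains c = x' ^+ 2 and c
  ^ a;
   these would have to anticommute, but tr (c * c ^ a) is nonzero. *)
Lemma solvabilizer_neq_order3 x x' : x \in S :\: Z -> x' \in S :\: Z -> commute x x' ->
  (tr x ^+ 2 = 1)%R -> tr x' != 0%R -> (tr x' ^+ 2 != 1)%R -> Sol x != Sol x'.
Proof.
move=> ncx ncx' cxx' t1 nt0 nt1.
wlog t1' : x ncx cxx' t1 / tr x = 1%R => [wl | ].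
  move/eqP: (t1); rewrite -[X in _ == X](expr1n _ 2) eqf_sqr => /orP[]/eqP tx; first exact: wl.
  have Sx := noncentral_SL2 ncx; rewrite -(solvabilizer_negone Sx); apply: wl.
  - exact: negoneM_notinZ.
  - apply/commute_sym; apply: commuteM; last exact/commute_sym.
    exact/commute_sym/(cz cZ)/(noncentral_SL2 ncx').
  - by rewrite trN sqrrN.
  by rewrite trN tx opprK.
move: t1' => {}t1.
have Sx := noncentral_SL2 ncx; have Sx' := noncentral_SL2 ncx'.
have [a [Sola ca tax]] := exists_tetrahedral ncx t1.
apply: contra_eq_neq ca => eqSol; move: Sola; rewrite eqSol => Sola.
have Sa : a \in S by move: Sola; rewrite inE => /andP[].
apply/eqP=> ca; have Sax : a ^ x \in S by rewrite groupJ.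
have [ta _ taax] := commg_negone_tr Sa Sax ca.
have nt4 : (tr x ^+ 2 != 4)%R by rewrite t1 expr1n eq_sym; case: two_lt4.
have eqC : 'C_S[x'] = 'C_S[x] by apply/esym/cent1_eq.
(* Commuting with [x] would give [a ^ x = a], and inverting [x] would give
   [tr (a * x) = - tr (a * x)], whereas this trace is - 1. *)
have notN : a \notin 'N('C_S[x]).
  apply/negP=> Na; have [/setIP[_ /cent1P cax] | [xa _ _]] := norm_torus ncx nt4 Sa Na.
    have e : a ^ x = a by apply/conjg_fixP/commgP.
    have aa1 : [~ a, a] = 1 by apply/eqP/commgP.
    by move/eqP: negone_neq1; rewrite -ca e aa1.
  have h : x * a = a * x^-1 by rewrite -xa conjgE mulKVg.
  have : (tr (a * x) = - tr (a * x))%R.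
    by rewrite {1}mxM mxtrace_mulC -mxM h mxM mxV // t1 mulmxBr mulmx1 linearB /= ta sub0r -mxM.
  by move/tr_eqN0/eqP; rewrite tax oppr_eq0 oner_eq0.
have notv v : v != 0%R -> x' \in line_stab v -> a \in line_stab v -> False.
  move=> nzv vx' va; have vx : x \in line_stab v.
    by apply: line_stab_cent1 ncx' vx' _; rewrite in_setI Sx; apply/cent1P.
  by apply: (line_stab_negone nzv va) ca; rewrite groupJ.
have x'2 : x' ^+ 2 \notin Z by rewrite expg2_center.
have x'3 : x' ^+ 3 \notin Z by rewrite expg3_center.
have [[b ncb [Nx' Na]] | [D frD [Nx' Na]]] := solvabilizer_cases ncx' Sola.
  have [t4 | nb4] := eqVneq (tr b ^+ 2)%R 4%R.
    have [v nzv [_ /subsetP sub]] := norm_unipotent_sub ncb t4.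
    by apply: (notv v nzv); apply: sub; apply/setIP.
  have [/setIP[_ /cent1P cxb] | [_ x'2Z _]] := norm_torus ncb nb4 Sx' Nx'.
    by case/negP: notN; rewrite -eqC (cent1_eq cA ncx' ncb cxb).
  by rewrite x'2Z in x'2.
have [h | [Dx2 x'4]] := frame_expg cZ cA frD Sx' Nx'; first by rewrite h in x'3.
have [c cE] : exists c, c = x' ^+ 2 by exists (x' ^+ 2).
rewrite -cE in Dx2 x'2; have Sc : c \in S by rewrite cE groupX.
have ncc : c \in S :\: Z by rewrite inE x'2.
have ccx' : commute x' c by rewrite cE; apply: commuteX.
have eqCc : 'C_S[c] = 'C_S[x] by rewrite -eqC; apply/esym/cent1_eq.
have Dca : c ^ a \in D by rewrite memJ_norm.
have tc : tr c = 0%R by apply/eqP; rewrite -expg2_center // cE -expgM.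
have := commg_frame frD Dx2 Dca; rewrite cZ !inE => /orP[/commgP e | /eqP e].
  case/negP: notN; rewrite -eqCc inE conj_cent1 //.
  have ncca : c ^ a \in S :\: Z.
    apply/setDP; split; first by rewrite groupJ.
    by rewrite memJ_norm // (subsetP (gFnorm _ _)).
  by rewrite (cent1_eq cA ncca ncc (commute_sym e)).
have Sca : c ^ a \in S by rewrite groupJ.
have [_ _ tcca] := commg_negone_tr Sc Sca e.
have Cc : c \in 'C_S[x] by rewrite -eqCc in_setI Sc; apply/cent1P.
have [k [l cl]] := elimT (cent1_SL2P ncx Sc) Cc.
have txa : tr (x * a) = (-1)%R by rewrite mxM mxtrace_mulC -mxM.
have kl : (2 * k + l = 0)%R by move: tc; rewrite cl mxtrace_linear2 t1 mulr1.
have dc : (k ^+ 2 + k * l + l ^+ 2 = 1)%R.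
  by have := elimT (SLP c) Sc; rewrite cl det_linear2 t1 (elimT (SLP x) Sx) !mulr1.
have tca : tr (c * a) = (- l)%R.
  by rewrite mxM cl mulmxDl mul_scalar_mx linearD /= linearZ /= ta mulr0 add0r -scalemxAl linearZ
    /= -mxM txa mulrN1.
have aV : a^-1 = negone * a.
  by apply/eqP; rewrite eq_invg_mul mulgA -(cz cZ Sa) -mulgA (sqr_tr0 Sa ta) (z2 cZ).
have : tr (c * c ^ a) = (2 - l ^+ 2)%R.
  have -> : c * c ^ a = negone * ((c * a) * (c * a)) by rewrite conjgE aV !mulgA (cz cZ Sc).
  rewrite trN mxM Cayley_Hamilton2 (elimT (SLP _) (groupM Sc Sa)) linearB linearZ /= tca.
  by rewrite mxtrace_scalar; ring.
rewrite tcca => /eqP; rewrite eq_sym subr_eq0 => /eqP l2.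
(* Determinant 1 and trace 0 of [c = k + l x] turn this identity into [3 * l ^+ 2 = 4], against
   [l ^+ 2 = 2]. *)
have e' : (3 * l ^+ 2 - 4 * (k ^+ 2 + k * l + l ^+ 2) = - (2 * k + l) ^+ 2)%R by ring.
rewrite dc kl -l2 in e'; case/eqP: two_neq0.
by rewrite -[RHS]oppr0 -[X in (- X)%R](expr0n _ 2) -e'; ring.
Qed.

(** The separating element is [e] from [exists_octahedral]. If it were in Sol(x'), then [x ^+ 2] and
    [a], its conjugate by [e], would lie in C(x') or fix a common line, although they
    anticommute. *)
Lemma solvabilizer_neq_order4 x x' : x \in S :\: Z -> x' \in S :\: Z -> commute x x' ->
  (tr x ^+ 2 = 2)%R -> generic x' -> Sol x != Sol x'.
Proof.
move=> ncx ncx' cxx' t2 gx'.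
have Sx := noncentral_SL2 ncx; have Sx' := noncentral_SL2 ncx'.
have [a [e [Sa ac ce Sole]]] := exists_octahedral ncx t2.
have Se : e \in S by move: Sole; rewrite inE => /andP[].
have Sc : x ^+ 2 \in S by rewrite groupX.
apply/eqP=> eqSol; move: Sole; rewrite eqSol => /(solvabilizer_genericP gx' Se).
have cx' : x ^+ 2 \in 'C_S[x'] by rewrite in_setI Sc; apply/cent1P/commute_sym/commuteX/commute_sym.
case=> [Ne | [v nzv [ve vx']]].
  have : a \in 'C_S[x'] by rewrite -ce memJ_norm.
  move=> ca; have /centsP/(_ a ca _ cx')/commgP := cA ncx'.
  by rewrite ac (negPf negone_neq1).
have vc := line_stab_cent1 ncx' vx' cx'.
by apply: (line_stab_negone nzv _ vc) ac; rewrite -ce groupJ.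
Qed.

(** The separating element is a generic [y] commuting with some [w] that anticommutes with [x]: [x]
    normalizes C(w). If [y] were in Sol(x'), then [x] and [w] would fix a common line, or [x'] would
    commute with [w], forcing [x] to do so, or [x'] would have trace 0. *)
Lemma solvabilizer_neq_order2 x x' : x \in S :\: Z -> x' \in S :\: Z -> commute x x' ->
  tr x = 0%R -> tr x' != 0%R -> Sol x != Sol x'.
Proof.
move=> ncx ncx' cxx' t0 nt0.
have Sx := noncentral_SL2 ncx; have Sx' := noncentral_SL2 ncx'.
have nt4 : (0 ^+ 2 != 4 :> F)%R.
  by rewrite expr0n /= eq_sym (_ : 4 = 2 ^+ 2)%R ?expf_neq0 //; ring.
have [w Sw xw] : exists2 w, w \in S & x ^ w = x^-1 by apply: exists_inverting; rewrite ?t0.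
have xV : x^-1 = negone * x.
  by apply/eqP; rewrite eq_invg_mul mulgA -(cz cZ Sx) -mulgA (sqr_tr0 Sx t0) (z2 cZ).
have cxw : [~ x, w] = negone by apply: conj_negone_commg; rewrite // xw.
have zV : negone^-1 = negone by apply/eqP; rewrite eq_invg_mul (z2 cZ).
have cwx : [~ w, x] = negone by rewrite -invg_comm cxw zV.
have [tw _ _] := commg_negone_tr Sw Sx cwx; have ncw := tr0_notinZ Sw tw.
have [y gy cwy] := exists_generic ncw; have /and3P[ncy _ _] := gy; have Sy := noncentral_SL2 ncy.
have eqC : 'C_S[y] = 'C_S[w] by apply/esym/cent1_eq.
have Cwy : w \in 'C_S[y] by rewrite eqC in_setI Sw; apply/cent1P.
have Solx : y \in Sol x.
  rewrite -solvabilizer_sym //; apply/(solvabilizer_genericP gy Sx); left.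
  by rewrite eqC inE conj_cent1 // (commg_negoneE Sw Sx cwx) cent1_negoneM.
apply: contraTneq Solx => ->; rewrite -solvabilizer_sym //.
apply/negP=> /(solvabilizer_genericP gy Sx').
have Cx'x : x \in 'C_S[x'] by rewrite in_setI Sx; apply/cent1P.
case=> [ | [v nzv [vx' vy]]]; last first.
  have vw := line_stab_cent1 ncy vy Cwy; have vx := line_stab_cent1 ncx' vx' Cx'x.
  exact: line_stab_negone nzv vw vx cwx.
rewrite eqC => /(norm_torus ncw _ Sx')[|Cx' | [_ x'2 _]]; first by rewrite tw.
  have cx'w : commute x' w by case/setIP: Cx' => _ /cent1P.
  have := commute_trans cA ncx' Sx Sw (commute_sym cxx') cx'w.
  by move/commgP; rewrite cxw (negPf negone_neq1).
by rewrite expg2_center // (negPf nt0) in x'2.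
Qed.

(* If x and x' fix no line and do not commute, then they anticommute, and for a generic g in C(x)
  the
   generic elements of C(g x') are in Sol(x) but not in Sol(x'). *)
Lemma solvabilizer_eq_cent1 x x' : x \in S :\: Z -> x' \in S :\: Z -> Sol x = Sol x' ->
  'C_S[x] = 'C_S[x'].
Proof.
move=> ncx ncx' eqSol.
have Sx := noncentral_SL2 ncx; have Sx' := noncentral_SL2 ncx'.
have [/existsP[v /andP[nzv vx]] | nov] := boolP [exists v, (v != 0%R) && (x \in line_stab v)].
  exact: solvabilizer_eq_line ncx ncx' eqSol nzv vx.
have [/existsP[v /andP[nzv vx]] | nov'] := boolP [exists v, (v != 0%R) && (x' \in line_stab v)].
  by apply/esym/(solvabilizer_eq_line ncx' ncx (esym eqSol) nzv vx).
have {}nov u v : u \in S :\: Z -> commute x u -> v != 0%R -> u \in line_stab v -> False.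
  move=> ncu cxu nzv vu; case/negP: nov; apply/existsP; exists v; rewrite nzv.
  by apply: line_stab_cent1 ncu vu _; rewrite in_setI Sx; apply/cent1P.
have {}nov' u v : u \in S :\: Z -> commute x' u -> v != 0%R -> u \in line_stab v -> False.
  move=> ncu cxu nzv vu; case/negP: nov'; apply/existsP; exists v; rewrite nzv.
  by apply: line_stab_cent1 ncu vu _; rewrite in_setI Sx'; apply/cent1P.
have not4 z (nz : forall u v, u \in S :\: Z -> commute z u -> v != 0%R -> u \in line_stab v ->
  False) u :
    u \in S :\: Z -> commute z u -> (tr u ^+ 2 != 4)%R.
  move=> ncu czu; apply/eqP=> t4; have [v nzv [vu _]] := norm_unipotent_sub ncu t4.
  exact: nz ncu czu nzv vu.
apply/eqP/cent1_eqP => //; apply/commgP; apply: contraT => /commgP ncomm.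
(* [a] fixes no line, so for [g] generic in C(a) the element [b] of Sol(g) must normalize C(g) =
   C(a); not commuting with [a], it inverts this torus. *)
have step a b (nca : a \in S :\: Z) (ncb : b \in S :\: Z) :
    (forall u v, u \in S :\: Z -> commute a u -> v != 0%R -> u \in line_stab v -> False) ->
    Sol a = Sol b -> ~ commute a b -> exists2 g, generic g /\ commute a g &
    [/\ a ^ b = a^-1, g ^ b = g^-1 & b ^+ 2 \in Z].
  move=> noa eqab nab; have [g gg cag] := exists_generic nca; have /and3P[ncg _ _] := gg.
  have Sa := noncentral_SL2 nca; have Sb := noncentral_SL2 ncb; have Sg := noncentral_SL2 ncg.
  have eqC := cent1_eq cA nca ncg cag.
  have : b \in Sol g.
    rewrite solvabilizer_sym // -eqab -solvabilizer_sym //.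
    apply/(solvabilizer_genericP gg Sa); left; rewrite -eqC.
    by apply: (subsetP (normG _)); rewrite in_setI Sa; apply/cent1P.
  case/(solvabilizer_genericP gg Sb) => [Nb | [v nzv [_ vg]]]; last by case: (noa g v).
  have Na : b \in 'N('C_S[a]) by rewrite eqC.
  exists g => //.
  have [/setIP[_ /cent1P cba] | [ab b2 _]] := norm_torus nca (not4 a noa a nca (commute_refl a))
    Sb Na.
    by case: nab; apply/commute_sym.
  have [/setIP[_ /cent1P cbg] | [gb _ _]] := norm_torus ncg (not4 a noa g ncg cag) Sb Nb.
    case: nab; have := commute_trans cA ncg Sa Sb (commute_sym cag) (commute_sym cbg).
    by [].
  by [].
have nx'x : ~ commute x' x by move/commute_sym.
have [g [gg cxg] [xx' gx' x'2]] := step x x' ncx ncx' nov eqSol ncomm.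
have [_ _ [x'x _ x2]] := step x' x ncx' ncx nov' (esym eqSol) nx'x.
have /and3P[ncg g3 g4] := gg; have Sg := noncentral_SL2 ncg.
have trZ z : z \in S :\: Z -> z ^+ 2 \in Z -> tr z = 0%R by move=> ncz;
  rewrite expg2_center // => /eqP.
have VN z : z \in S :\: Z -> z ^+ 2 \in Z -> z^-1 = negone * z.
  move=> ncz z2Z; have Sz := noncentral_SL2 ncz.
  by apply/eqP; rewrite eq_invg_mul mulgA -(cz cZ Sz) -mulgA (sqr_tr0 Sz (trZ z ncz z2Z)) (z2 cZ).
pose h := g * x'; have Sh : h \in S by rewrite groupM.
have hx : h ^ x = negone * h.
  rewrite /h conjMg x'x (VN x') // (_ : g ^ x = g); first by rewrite !mulgA (cz cZ Sg).
  by apply/conjg_fixP/commgP/commute_sym.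
have chx := conj_negone_commg Sh Sx hx.
have [th _ _] := commg_negone_tr Sh Sx chx; have nch := tr0_notinZ Sh th.
have [y gy chy] := exists_generic nch; have /and3P[ncy _ _] := gy; have Sy := noncentral_SL2 ncy.
have eqC : 'C_S[y] = 'C_S[h] by apply/esym/cent1_eq.
have : x' \in Sol y.
  rewrite solvabilizer_sym // -eqSol -solvabilizer_sym //.
  apply/(solvabilizer_genericP gy Sx); left.
  by rewrite eqC inE conj_cent1 // hx cent1_negoneM.
case/(solvabilizer_genericP gy Sx') => [Nx' | [v nzv [vx' _]]]; last by case: (nov' x' v).
have nt4 : (tr h ^+ 2 != 4)%R.
  by rewrite th expr0n /= eq_sym (_ : 4 = 2 ^+ 2)%R ?expf_neq0 //; ring.
rewrite eqC in Nx'; have [/setIP[_ /cent1P cx'h] | [hx' _ _]] := norm_torus nch nt4 Sx' Nx'.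
  have e : g * x' * x' = x' * g * x' by rewrite -[RHS]mulgA -/h cx'h.
  by case: ncomm; apply: (commute_trans cA ncg Sx Sx' (commute_sym cxg) (mulIg _ _ _ e)).
(* [x'] inverts both [g] and [h = g * x'], where the inverse of [h] is [negone * h]. Comparing shows
   that [g ^+ 2] is central, against genericity. *)
have gV : g^-1 = negone * g.
  apply: (mulIg x'); move: hx'; rewrite {1}/h conjMg gx' [x' ^ x']conjgE mulKg => ->.
  rewrite (VN h) ?mulgA // expgS expg1 -[h * h]/(h * h) (sqr_tr0 Sh th).
  by rewrite cZ !inE eqxx orbT.
suff g2 : g ^+ 2 \in Z by case/negP: g4; rewrite (expgM _ 2 2); apply: groupX.
rewrite expgS expg1 cZ !inE.
have -> : g * g = negone by apply: (mulgI negone); rewrite mulgA -gV mulVg (z2 cZ).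
by rewrite eqxx orbT.
Qed.

(** * Counting the centralizers *)

Lemma card_SL2_nsqrt r : #|[set x in S | nsqrt (disc x) == r]| =
  (#|[set t : F | nsqrt (t ^+ 2 - 4)%R == r]| * (q * q.-1 + q * r))%N.
Proof.
rewrite -sum_nat_const -[LHS]sum1_card.
rewrite (partition_big (fun x => tr x) (mem [set t : F | nsqrt (t ^+ 2 - 4)%R == r])) /=.
  apply: eq_bigr => t; rewrite inE => /eqP rt; rewrite -[in RHS]rt -card_SL2_trace -sum1_card.
  apply: eq_bigl => x; apply/andP/setIdP => [[/setIdP[Sx _] tx] // | [Sx /eqP tx]].
  by split; [apply/setIdP; rewrite tx rt | rewrite tx].
by move=> x /setIdP[_]; rewrite inE.
Qed.

Lemma card_cent1_cases x : x \in S :\: Z ->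
  [\/ nsqrt (disc x) = 2 /\ #|'C_S[x]| = q.-1, nsqrt (disc x) = 0%N /\ #|'C_S[x]| = q.+1 |
      nsqrt (disc x) = 1%N /\ #|'C_S[x]| = (2 * q)%N].
Proof.
move=> ncx; have [t4 | nt4] := eqVneq (tr x ^+ 2)%R 4%R.
  by constructor 3; rewrite t4 subrr nsqrt0 card_cent1_unipotent.
have := card_torus ncx nt4; have : (disc x != 0)%R by rewrite subr_eq0.
case: (nsqrtP two_neq0) => // _ _; rewrite addn1 ?addn0.
  by rewrite addn2 => -[<-]; constructor 1.
by move=> ->; constructor 2.
Qed.

Lemma nsqrt_center x : x \in Z -> nsqrt (disc x) = 1%N.
Proof. by move/center_trace->; rewrite subrr nsqrt0. Qed.

(** The two central elements have trace 2 and - 2, so they add to the class [r = 1] only. *)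
Lemma card_nsqrt_noncentral r n :
  (forall x, x \in S :\: Z -> (nsqrt (disc x) == r) = (#|'C_S[x]| == n)) ->
  (#|max_tori n| * (n - 2) + (if r == 1%N then 2 else 0))%N =
  #|[set x in S | nsqrt (disc x) == r]|.
Proof.
move=> rn; rewrite card_max_tori -[RHS](cardsID Z) addnC; congr (_ + _)%N.
  case: eqP => r1; last first.
    apply/esym/eqP; rewrite cards_eq0; apply/eqP/setP=> x; rewrite in_set0.
    apply/negP=> /setIP[/setIdP[_ /eqP e] Zx].
    by case: r1; rewrite -e nsqrt_center.
  apply: etrans (esym card_center) _; apply: eq_card => x; apply/idP/setIP => [Zx | [] //].
  by split=> //; apply/setIdP; rewrite nsqrt_center // r1; split=> //; case/setIP: Zx.
apply: eq_card => x; apply/setIdP/setDP => [[ncx cx] | [/setIdP[Sx rx] nZx]].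
  by have [Sx nZ] := setDP ncx; split=> //; apply/setIdP; rewrite rn.
by have ncx : x \in S :\: Z by [apply/setDP]; rewrite ncx -rn.
Qed.

(** There are (q - 3) / 2 split traces with q (q + 1) elements each, and q - 3 noncentral elements
    in each torus. *)
Lemma card_split_tori : (2 * #|max_tori q.-1| = q * q.+1)%N.
Proof.
have [T2 _] := card_split_traces two_neq0.
have rn x : x \in S :\: Z -> (nsqrt (disc x) == 2) = (#|'C_S[x]| == q.-1).
  by move=> ncx; case: (card_cent1_cases ncx) => -[-> ->]; lia.
have := card_nsqrt_noncentral rn; rewrite card_SL2_nsqrt /= addn0 => e.
move: e; set k := #|max_tori _|; set T := #|_| in T2 * => e.
have q3 : (q.-1 - 2 = 2 * T)%N by lia.
have T0 : (0 < 2 * T)%N by lia.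
apply/eqP; rewrite -(eqn_pmul2r T0) -mulnA -{1}q3 e; apply/eqP.
have -> : (q * q.-1 + q * 2 = q * q.+1)%N by rewrite -mulnDr; congr (_ * _)%N; lia.
by rewrite mulnA mulnC.
Qed.

Lemma card_nonsplit_tori : (2 * #|max_tori q.+1| = q * q.-1)%N.
Proof.
have [_ T2] := card_split_traces two_neq0.
have rn x : x \in S :\: Z -> (nsqrt (disc x) == 0%N) = (#|'C_S[x]| == q.+1).
  by move=> ncx; case: (card_cent1_cases ncx) => -[-> ->]; lia.
have := card_nsqrt_noncentral rn; rewrite card_SL2_nsqrt /= addn0 muln0 addn0 => e.
move: e; set k := #|max_tori _|; set T := #|_| in T2 * => e.
have q3 : (q.+1 - 2 = 2 * T)%N by lia.
have T0 : (0 < 2 * T)%N by lia.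
apply/eqP; rewrite -(eqn_pmul2r T0) -mulnA -{1}q3 e; apply/eqP.
by rewrite mulnA mulnC.
Qed.

Lemma card_unipotent_tori : #|max_tori (2 * q)%N| = q.+1.
Proof.
have rn x : x \in S :\: Z -> (nsqrt (disc x) == 1%N) = (#|'C_S[x]| == 2 * q)%N.
  by move=> ncx; case: (card_cent1_cases ncx) => -[-> ->]; lia.
have := card_nsqrt_noncentral rn; rewrite card_SL2_nsqrt card_unipotent_traces //=.
set k := #|max_tori _| => e.
have [n qn] : exists n, q = n.+2 by exists (q - 2)%N; lia.
rewrite qn in e *; apply/eqP; rewrite -(eqn_pmul2r (isT : 0 < n.+1)); apply/eqP.
lia.
Qed.

(** * Counting the solvabilizers *)

Definition tori := [set 'C_S[x] | x in S :\: Z].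

Lemma card_tori (P : pred nat) : #|[set T in tori | P #|T|]| =
  (P q.-1 * #|max_tori q.-1| + P q.+1 * #|max_tori q.+1| + P (2 * q)%N * #|max_tori (2 * q)%N|)%N.
Proof.
have cardA (A : {set {set gT}}) : #|A| = (\sum_(T : {set gT}) (T \in A))%N.
  by rewrite -sum1_card big_mkcond; apply: eq_bigr => T _; case: (T \in A).
rewrite !cardA !big_distrr -!big_split /=; apply: eq_bigr => T _; rewrite !in_set -/tori.
case: (boolP (T \in tori)) => [/imsetP[x ncx ->] | _] /=; last by rewrite !muln0.
have [d1 d2 d3] : [/\ q.-1 != q.+1, q.-1 != (2 * q)%N & q.+1 != (2 * q)%N] by split; lia.
case: (card_cent1_cases ncx) => -[_ ->]; rewrite eqxx muln1.
- by rewrite (negPf d1) (negPf d2) !muln0 !addn0.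
- by rewrite eq_sym (negPf d1) (negPf d3) !muln0 addn0.
by rewrite ![(2 * q)%N == _]eq_sym (negPf d2) (negPf d3) !muln0.
Qed.

(** The types are separated in the order 2, 3, 4, because each separation supposes that the other
    element is not of an earlier type. *)
Lemma solvabilizer_eq_trace x x' : x \in S :\: Z -> x' \in S :\: Z -> Sol x = Sol x' ->
  [/\ (tr x ^+ 2 == 0) = (tr x' ^+ 2 == 0), (tr x ^+ 2 == 1) = (tr x' ^+ 2 == 1) &
      (tr x ^+ 2 == 2) = (tr x' ^+ 2 == 2)]%R.
Proof.
have comm y y' : y \in S :\: Z -> y' \in S :\: Z -> Sol y = Sol y' -> commute y y'.
  by move=> ncy ncy' e; apply/(cent1_eqP cA ncy ncy')/eqP/solvabilizer_eq_cent1.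
have main0 y y' : y \in S :\: Z -> y' \in S :\: Z -> Sol y = Sol y' ->
    (tr y ^+ 2 == 0)%R -> (tr y' ^+ 2 == 0)%R.
  move=> ncy ncy' e; rewrite !sqrf_eq0 => /eqP t0; apply: contraT => nt0.
  by have := solvabilizer_neq_order2 ncy ncy' (comm _ _ ncy ncy' e) t0 nt0; rewrite e eqxx.
have main1 y y' : y \in S :\: Z -> y' \in S :\: Z -> Sol y = Sol y' ->
    (tr y ^+ 2 == 1)%R -> (tr y' ^+ 2 == 1)%R.
  move=> ncy ncy' e /eqP t1; apply: contraT => nt1; have [nt0 | nt0] := eqVneq (tr y') 0%R.
    have := main0 y' y ncy' ncy (esym e); rewrite nt0 t1 expr0n eqxx => /(_ isT).
    by rewrite (negPf (oner_neq0 _)).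
  by have := solvabilizer_neq_order3 ncy ncy' (comm _ _ ncy ncy' e) t1 nt0 nt1; rewrite e eqxx.
have main2 y y' : y \in S :\: Z -> y' \in S :\: Z -> Sol y = Sol y' ->
    (tr y ^+ 2 == 2)%R -> (tr y' ^+ 2 == 2)%R.
  move=> ncy ncy' e /eqP t2; apply: contraT => nt2.
  have gy' : generic y'.
    rewrite genericP // nt2 andbT -sqrf_eq0; apply/andP; split; apply/negP.
      by move/(main0 y' y ncy' ncy (esym e)); rewrite t2 (negPf two_neq0).
    move/(main1 y' y ncy' ncy (esym e)); rewrite t2 -subr_eq0 (_ : 2 - 1 = 1)%R; last by ring.
    by rewrite (negPf (oner_neq0 _)).
  by have := solvabilizer_neq_order4 ncy ncy' (comm _ _ ncy ncy' e) t2 gy'; rewrite e eqxx.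
move=> ncx ncx' e; split; apply/idP/idP.
- exact: main0. - exact: (main0 _ _ _ _ (esym e)).
- exact: main1. - exact: (main1 _ _ _ _ (esym e)).
- exact: main2. exact: (main2 _ _ _ _ (esym e)).
Qed.

Lemma solvabilizer1 : Sol 1 = S.
Proof.
apply/setP=> y; rewrite inE; case Sy: (y \in S) => //=.
by apply: solvableS (abelian_sol (cycle_abelian y));
  rewrite gen_subG subUset !sub1set group1 cycle_id.
Qed.

(** If every transvection is in Sol(x), then [x] fixes every line; the lines of (1, 0), (0, 1) and
    (1, 1) suffice to make it scalar. *)
Lemma solvabilizer_neq_SL2 x : x \in S :\: Z -> Sol x != S.
Proof.
move=> ncx; have [Sx nZ] := setDP ncx; apply: contra nZ => /eqP SolS.
have stab v : v != 0%R -> exists l, (v *m mx x = l *: v)%R.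
  move=> nzv; have [u [ncu _ _] Solu] := exists_unipotent nzv; have Su := noncentral_SL2 ncu.
  by have : x \in line_stab v; [rewrite -Solu // solvabilizer_sym // SolS | case/line_stabP].
pose rv (a b : F) : 'rV[F]_2 := (\row_j if j == 0 then a else b)%R.
have rvE (a b : F) : (rv a b 0 0 = a)%R * (rv a b 0 1 = b)%R by rewrite !mxE.
have nz (a b : F) : ((a != 0) || (b != 0))%R -> rv a b != 0%R.
  by apply: contraTneq => /rowP e; have := e 0%R; have := e 1%R; rewrite !mxE /= => -> ->;
    rewrite eqxx.
have ent (a b : F) : ((a != 0) || (b != 0))%R -> exists l,
    (a * mx x 0 0 + b * mx x 1 0 = l * a /\ a * mx x 0 1 + b * mx x 1 1 = l * b)%R.
  move=> /nz/stab[l /rowP e]; exists l; have := e 0%R; have := e 1%R.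
  by rewrite !mul2E !scalemxE !rvE.
have nz1 : (1 != 0 :> F)%R := oner_neq0 _.
have [l1 [_]] := ent 1%R 0%R (introT orP (or_introl nz1)); rewrite mul1r mul0r addr0 mulr0 => x01.
have [l2 [+ _]] := ent 0%R 1%R (introT orP (or_intror nz1)); rewrite mul1r mul0r add0r mulr0 => x10.
have [l [e0 e1]] := ent 1%R 1%R (introT orP (or_introl nz1)).
rewrite x01 x10 !mul1r !mulr1 addr0 add0r in e0 e1.
by apply/(SL2_scalarP Sx); exists l; apply: mx2P; rewrite !lin2E.
Qed.

(** The centre, the generic elements and the elements of squared trace 0, 1, 2 have disjoint sets of
    solvabilizers. Within a noncentral class solvabilizers correspond to the centralizers meeting
    it. Unipotent centralizers are absent from [k], as none of 3, 4, 8 divides [2 * q]. *)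
Lemma card_Solv_SL2 :
  let k d := (((d %| q.-1) * #|max_tori q.-1| + (d %| q.+1) * #|max_tori q.+1|))%N in
  #|Solv S| = (1 + (#|max_tori q.-1| + #|max_tori q.+1| + q.+1) + k 4 + k 3 + k 8)%N.
Proof.
pose A c := [set x in S :\: Z | (tr x ^+ 2 == c)%R].
pose A0 := [set x in S :\: Z | generic x].
have ZS : S = Z :|: (A0 :|: A 0%R :|: A 1%R :|: A 2%R) :> {set gT}.
  apply/setP=> x; apply/idP/setUP => [Sx | [Zx | ]]; last 1 first.
  - by rewrite !in_setU => /orP[/orP[/orP[]|]|] /setIdP[/noncentral_SL2].
  - have [Zx | nZ] := boolP (x \in Z); [by left | right].
    have ncx : x \in S :\: Z by apply/setDP.
    have inA c : (x \in A c) = (tr x ^+ 2 == c)%R by rewrite in_set ncx.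
    rewrite !in_setU !inA [x \in A0]in_set ncx genericP // sqrf_eq0.
    by case: (tr x == 0)%R; case: (tr x ^+ 2 == 1)%R; case: (tr x ^+ 2 == 2)%R.
  by case/setIP: Zx.
have SolZ : Sol @: Z = [set S : {set gT}].
  apply/setP=> B; rewrite in_set1; apply/imsetP/eqP => [[x + ->] | ->]; last first.
    by exists 1; rewrite ?group1 ?solvabilizer1.
  rewrite cZ !inE => /orP[]/eqP->; first exact: solvabilizer1.
  by rewrite -[negone]mulg1 solvabilizer_negone ?solvabilizer1.
have neq12 : (1 != 2 :> F)%R.
  by rewrite -subr_eq0 (_ : 1 - 2 = - 1)%R ?oppr_eq0 ?oner_neq0 //; ring.
have genN x : x \in A0 -> [/\ x \in S :\: Z, (tr x ^+ 2 != 0), (tr x ^+ 2 != 1) & (tr x ^+ 2 !=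
  2)]%R.
  by case/setIdP=> ncx; rewrite genericP // sqrf_eq0 => /and3P[].
have sub c x : x \in A c -> x \in S :\: Z /\ (tr x ^+ 2 = c)%R by case/setIdP=> ncx /eqP.
have neqS (B C : {set gT}) (f : F -> bool) : {in B, forall x, x \in S :\: Z /\ f (tr x ^+ 2)%R} ->
    {in C, forall x, x \in S :\: Z /\ ~~ f (tr x ^+ 2)%R} ->
    (forall x x', x \in S :\: Z -> x' \in S :\: Z -> Sol x = Sol x' ->
      f (tr x ^+ 2)%R = f (tr x' ^+ 2)%R) ->
    {in B & C, forall x y, Sol x != Sol y}.
  move=> fB fC fS x y Bx Cy; have [ncx fx] := fB x Bx; have [ncy fy] := fC y Cy.
  by apply: contra fy => /eqP /(fS x y ncx ncy) <-.
have cardSol : #|Solv S| = (1 + (#|Sol @: A0| + #|Sol @: A 0%R| + #|Sol @: A 1%R| + #|Sol @: A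
  2%R|))%N.
  have -> : Solv S = Sol @: (Z :|: (A0 :|: A 0%R :|: A 1%R :|: A 2%R)) by rewrite -ZS.
  rewrite card_imsetU_disjoint; last first.
    move=> x y Zx Uy; have -> : Sol x = S by apply/set1P; rewrite -SolZ imset_f.
    rewrite eq_sym; apply: solvabilizer_neq_SL2.
    by move: Uy; rewrite !in_setU => /orP[/orP[/orP[]|]|] /setIdP[].
  rewrite SolZ cards1; congr (1 + _)%N.
  rewrite card_imsetU_disjoint; last first.
    apply: (neqS _ _ (fun c => c != 2%R)).
    - move=> x; rewrite !in_setU => /orP[/orP[|]|] => [/genN[] // | /sub[ncx ->] | /sub[ncx ->]];
      split=> //.
      by rewrite eq_sym.
    - by move=> x /sub[ncx ->]; rewrite eqxx.
    by move=> x x' ncx ncx' /(solvabilizer_eq_trace ncx ncx')[_ _ ->].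
  congr (_ + _)%N; rewrite card_imsetU_disjoint; last first.
    apply: (neqS _ _ (fun c => c != 1%R)).
    - move=> x; rewrite !in_setU => /orP[|] => [/genN[] // | /sub[ncx ->]]; split=> //.
      by rewrite eq_sym oner_neq0.
    - by move=> x /sub[ncx ->]; rewrite eqxx.
    by move=> x x' ncx ncx' /(solvabilizer_eq_trace ncx ncx')[_ -> _].
  congr (_ + _)%N; rewrite card_imsetU_disjoint //.
  apply: (neqS _ _ (fun c => c != 0%R)).
  - by move=> x /genN[].
  - by move=> x /sub[ncx ->]; rewrite eqxx.
  by move=> x x' ncx ncx' /(solvabilizer_eq_trace ncx ncx')[-> _ _].
have SolC (B : {set gT}) : {in B, forall x, x \in S :\: Z} ->
    {in B &, forall x y, 'C_S[x] = 'C_S[y] -> Sol x = Sol y} ->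
    #|Sol @: B| = #|[set 'C_S[x] | x in B]|.
  move=> BS BC; apply/eqP; rewrite eqn_leq; apply/andP; split;
    apply: leq_card_imset_fibre => // x y Bx By.
  by apply: solvabilizer_eq_cent1; apply: BS.
have ndvd d : d \in [:: 3; 4; 8] -> (d %| 2 * q)%N = false.
  move=> dE; apply/negP=> d2q.
  have o2 : ~~ (4 %| 2 * q)%N by rewrite (@dvdn_pmul2l 2 2 q) // dvdn2 card_F_odd.
  move: dE d2q; rewrite !inE => /or3P[]/eqP->.
  - by rewrite Gauss_dvdr // (negPf card_F_3).
  - exact/negP.
  by move=> h; case/negP: o2; apply: dvdn_trans h.
have CA0 : #|Sol @: A0| = (#|max_tori q.-1| + #|max_tori q.+1| + q.+1)%N.
  rewrite SolC; last first.
  - by move=> x y /setIdP[_ gx] /setIdP[_ gy]; apply: solvabilizer_generic.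
  - by move=> x /setIdP[].
  have -> : [set 'C_S[x] | x in A0] = [set T in tori | predT #|T|].
    apply/setP=> T; apply/imsetP/setIdP => [[x /setIdP[ncx _] ->] | [/imsetP[x ncx ->] _]].
      by split=> //; apply: imset_f.
    have [y gy cxy] := exists_generic ncx; have /and3P[ncy _ _] := gy.
    by exists y; [apply/setIdP | apply: (cent1_eq cA ncx ncy cxy)].
  by rewrite card_tori !mul1n card_unipotent_tori.
have CA c d : (c, d) \in [:: (0%R, 4); (1%R, 3); (2%:R%R, 8)] ->
    #|Sol @: A c| = (((d %| q.-1) * #|max_tori q.-1| + (d %| q.+1) * #|max_tori q.+1|))%N.
  move=> cd; have c4 : (c != 4)%R.
    have [n2 n1] := two_lt4; rewrite !inE in cd; rewrite eq_sym.
    by case/or3P: cd => /eqP[-> _] //; apply: (four_neq0 two_neq0).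
  have dE : d \in [:: 3; 4; 8] by rewrite !inE in cd *; case/or3P: cd => /eqP[_ ->].
  rewrite SolC; last first.
  - move=> x y /sub[ncx tx] /sub[ncy ty] eqC; apply: solvabilizer_same_trace; rewrite ?tx ?ty //.
    by rewrite -eqC in_setI (noncentral_SL2 ncx); apply/cent1P.
  - by move=> x /sub[].
  have -> : [set 'C_S[x] | x in A c] = [set T in tori | (fun n => d %| n) #|T|].
    apply/setP=> T; apply/imsetP/setIdP => [[x /sub[ncx tx] ->] | [/imsetP[x ncx ->] dT]].
      split; first exact: imset_f.
      by apply/(torus_traceP ncx cd); exists x.
    have [y ncy [cxy ty]] := proj2 (torus_traceP ncx cd) dT.
    by exists y; [apply/setIdP; rewrite ty | apply: (cent1_eq cA ncx ncy cxy)].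
  by rewrite card_tori ndvd // mul0n addn0.
by rewrite /= cardSol CA0 (@CA 0%R 4) ?(@CA 1%R 3) ?(@CA 2%R 8) ?inE ?eqxx ?orbT //.
Qed.

End SL2Theory.

Lemma card_Solv_PSL2 (p : nat) : prime p -> 10 < p ->
  exists k2 k0, [/\ 2 * k2 = p * p.+1, 2 * k0 = p * p.-1 &
    #|Solv (PSL2 p)| = 1 + (k2 + k0 + p.+1) + ((4 %| p.-1) * k2 + (4 %| p.+1) * k0) +
      ((3 %| p.-1) * k2 + (3 %| p.+1) * k0) + ((8 %| p.-1) * k2 + (8 %| p.+1) * k0)].
Proof.
move=> p_pr p_gt10; have cF := card_Fp p_pr.
have natF n : 0 < n < 10 -> (n%:R != 0 :> 'F_p)%R.
  case/andP=> n0 n8; rewrite -(dvdn_pcharf (pchar_Fp p_pr)).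
  apply/negP=> /(dvdn_leq n0); lia.
pose mx (g : {'GL_2['F_p]}) : 'M['F_p]_2 := GLval g.
have mxM g h : mx (g * h)%g = (mx g *m mx h)%R by [].
have mx_inj : injective mx by apply: val_inj.
have SLP g : reflect (\det (mx g) = 1)%R (g \in SL2 p) by rewrite inE; apply: eqP.
have exSL (A : 'M['F_p]_2) : (\det A = 1)%R -> exists2 g, g \in SL2 p & mx g = A.
  move=> dA; have uA : A \is a GRing.unit by have : A \in unitmx by rewrite unitmxE dA unitr1.
  by exists (Sub A uA); [apply/SLP; rewrite /mx SubK | rewrite /mx SubK].
have F_gt10 : 10 < #|'F_p| by rewrite cF.
have F_3 : ~~ (3 %| #|'F_p|) by rewrite cF dvdn_prime2 //; lia.
have n2 : (2 != 0 :> 'F_p)%R := natF 2 isT.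
have n3 : (3 != 0 :> 'F_p)%R := natF 3 isT.
have e1 := card_split_tori mxM mx_inj SLP exSL n2 n3 F_gt10 F_3.
have e2 := card_nonsplit_tori mxM mx_inj SLP exSL n2 n3 F_gt10 F_3.
have e3 := card_Solv_SL2 mxM mx_inj SLP exSL n2 n3 F_gt10 F_3.
rewrite cF in e1 e2 e3; move: e1 e2 e3.
set k2 := #|max_tori _ _|; set k0 := #|max_tori _ _| => e1 e2 e3.
exists k2, k0; split; [exact: e1 | exact: e2 |].
by rewrite [LHS](card_Solv_quotient_center (SL2 p)) e3.
Qed.

(* The eight cases; those with half-integer coefficients are multiplied by 2
   to stay in nat. *)
Theorem theorem4p5 (p : nat) : prime p -> 7 < p ->
  let N := #|Solv (PSL2 p)| in
  (p %% 24 = 1 -> 2 * N = 5 * p ^ 2 + 5 * p + 4) /\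
  (p %% 24 = 5 -> N = 2 * p ^ 2 + p + 2) /\
  (p %% 24 = 7 -> 2 * N = 5 * p ^ 2 + p + 4) /\
  (p %% 24 = 11 -> N = 2 * p ^ 2 + 2) /\
  (p %% 24 = 13 -> N = 2 * p ^ 2 + 2 * p + 2) /\
  (p %% 24 = 17 -> 2 * N = 5 * p ^ 2 + 3 * p + 4) /\
  (p %% 24 = 19 -> N = 2 * p ^ 2 + p + 2) /\
  (p %% 24 = 23 -> 2 * N = 5 * p ^ 2 - p + 4).
Proof.
move=> p_pr p_gt7 N; have p_gt10 : 10 < p.
  have np n : ~~ prime n -> p != n by apply: contraNneq => <-.
  have := np 8 isT; have := np 9 isT; have := np 10 isT; lia.
have [k2 [k0 [e2 e0 NE]]] := card_Solv_PSL2 p_pr p_gt10.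
(* The divisors 3, 4, 8 divide 24, so the residue of [p] decides all the divisibilities. *)
have dvdE d r : d %| 24 -> p %% 24 = r ->
    (d %| p.-1) = (r %% d == 1 %% d) /\ (d %| p.+1) = (r.+1 %% d == 0).
  move=> d24 <-; split; last by rewrite -[(p %% 24).+1]addn1 -modnDml modn_dvdm // modnDml addn1.
  by rewrite -subn1 -eqn_mod_dvd ?(ltn_trans _ p_gt10) // modn_dvdm.
have pP : p * p.+1 = p ^ 2 + p by rewrite mulnS addnC.
have pM : p * p.-1 = p ^ 2 - p by rewrite -subn1 mulnBr muln1.
(* Subtraction is truncated; with this bound, and [p ^ 2] generalized to a variable, the eight cases
   are linear. *)
have pp : p <= p ^ 2 by rewrite leq_pmulr // (ltn_trans _ p_gt10).
move: e2 e0 NE pp; rewrite -/N pP pM; set P := p ^ 2; clearbody P N => e2 e0 NE pp.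
do 7?split; move=> pr; move: NE;
  have [-> ->] := dvdE 4 _ isT pr; have [-> ->] := dvdE 3 _ isT pr; have [-> ->] := dvdE 8 _ isT pr;
  rewrite /=; clear -e2 e0 pp; lia.
Qed.
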